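(* Let $\varphi,\psi:\mathbb{D}\to\mathbb{D}$ be two parabolic holomorphic self-maps having the same Denjoy–Wolff point $\tau$. If there exist $c_1,c_2\in\mathbb{C}$ and a holomorphic function $h:\mathbb{D}\to\mathbb{C}$ which is univalent in some domain $V\subset\mathbb{D}$ isogonal at $\tau$ and such that $$h\circ\varphi=h+c_1,\qquad h\circ\psi=h+c_2,$$ then $\varphi\circ\psi=\psi\circ\varphi$. In particular, if $h_\varphi\circ\psi=h_\varphi+c$ for some constant $c\in\mathbb{C}$, where $h_\varphi$ is the Koenigs function of $\varphi$, then $\psi\circ\varphi=\varphi\circ\psi$.
   Context: $\mathbb{D}=\{z\in\mathbb{C}:|z|<1\}$, $\mathbb{H}=\{w\in\mathbb{C}:\operatorname{Im}w>0\}$, and $\rho_{\mathbb{D}}$ denotes the hyperbolic distance in $\mathbb{D}$. ''Univalent'' means holomorphic and injective. A holomorphic self-map $\varphi$ of $\mathbb{D}$ is parabolic if its iterates converge locally uniformly to a point $\tau\in\partial\mathbb{D}$ (its Denjoy–Wolff point) and the angular derivative satisfies $\varphi'(\tau)=1$. The limit $\lim_{n\to\infty}\rho_{\mathbb{D}}(\varphi^{\circ n}(z),\varphi^{\circ(n+1)}(z))$ is either zero for all $z\in\mathbb{D}$ (zero hyperbolic step) or positive for all $z\in\mathbb{D}$ (positive hyperbolic step). A domain $U\subset\mathbb{D}$ is isogonal at $\sigma\in\partial\mathbb{D}$ if for any Stolz angle $S\subset\mathbb{D}$ with vertex at $\sigma$ there exists $\varepsilon>0$ such that $\{z\in S:|z-\sigma|<\varepsilon\}\subset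 U$. Koenigs function of a parabolic $\varphi$: the function $h_\varphi$ is the unique holomorphic $h:\mathbb{D}\to S$ such that $h\circ\varphi=h+1$, $S=\bigcup_{n\ge0}(h(\mathbb{D})-n)$, and $h$ is injective on some $\varphi$-absorbing domain (a domain $W\subset\mathbb{D}$ with $\varphi(W)\subset W$ and $\mathbb{D}=\bigcup_{n\in\mathbb{N}}(\varphi^{\circ n})^{-1}(W)$), where: if $\varphi$ is of zero hyperbolic step, $S=\mathbb{C}$ and $h(0)=0$; if $\varphi$ is of positive hyperbolic step, $S=\mathbb{H}$ or $S=-\mathbb{H}$ (which of the two is determined by $\varphi$) and $\operatorname{Re}h(0)=0$. *)

(* Defs.v *)
(* Functions on (subsets of) the unit disk are total maps [C -> C]; every
   predicate below only constrains their values on the set at hand. *)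
From Stdlib Require Import Reals.
From Coquelicot Require Import Coquelicot.

Open Scope C_scope.

Definition disk (z : C) : Prop := (Cmod z < 1)%R.

Definition upper_half_plane (w : C) : Prop := (0 < Im w)%R.

Definition lower_half_plane (w : C) : Prop := (Im w < 0)%R.

Definition subset (A B : C -> Prop) : Prop := forall z, A z -> B z.

Definition connected (U : C -> Prop) : Prop :=
  forall A B : C -> Prop,
    @open C_UniformSpace A -> @open C_UniformSpace B ->
    (forall z, U z -> A z \/ B z) ->
    (exists z, U z /\ A z) -> (exists z, U z /\ B z) ->
    exists z, U z /\ A z /\ B z.

Definition domain (U : C -> Prop) : Prop :=
  (exists z, U z) /\ @open C_UniformSpace U /\ connected U.

(* The scalar field is [C_AbsRing], so this is complex differentiability. *)
Definition holomorphic_on (U : C -> Prop) (f : C -> C) : Prop :=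
  forall z, U z -> @ex_derive C_AbsRing C_NormedModule f z.

Definition injective_on (U : C -> Prop) (f : C -> C) : Prop :=
  forall z w, U z -> U w -> f z = f w -> z = w.

Definition univalent_on (U : C -> Prop) (f : C -> C) : Prop :=
  holomorphic_on U f /\ injective_on U f.

Definition holomorphic_self_map (f : C -> C) : Prop :=
  holomorphic_on disk f /\ forall z, disk z -> disk (f z).

(* Stolz angle with vertex [sigma] on the unit circle; its aperture grows
   with [k > 1], and it is contained in the disk. *)
Definition stolz_angle (sigma : C) (k : R) (z : C) : Prop :=
  disk z /\ (Cmod (z - sigma) < k * (1 - Cmod z))%R.

Definition isogonal (U : C -> Prop) (sigma : C) : Prop :=
  domain U /\ subset U disk /\
  forall k : R, (1 < k)%R ->
    exists eps : R, (0 < eps)%R /\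
      forall z, stolz_angle sigma k z -> (Cmod (z - sigma) < eps)%R -> U z.

Definition angular_limit (f : C -> C) (sigma l : C) : Prop :=
  forall k : R, (1 < k)%R ->
    filterlim f
      (within (stolz_angle sigma k) (@locally C_UniformSpace sigma))
      (@locally C_UniformSpace l).

(* Angular derivative at a boundary point [sigma] which [f] fixes in the sense
   of angular limits, as is the case for a boundary Denjoy-Wolff point. *)
Definition is_angular_derivative (f : C -> C) (sigma d : C) : Prop :=
  angular_limit f sigma sigma /\
  angular_limit (fun z => (f z - sigma) / (z - sigma)) sigma d.

Definition iterate (n : nat) (f : C -> C) (z : C) : C := Nat.iter n f z.

Definition iterates_converge_locally_uniformly (f : C -> C) (tau : C) : Prop :=
  forall z0, disk z0 ->
    exists r : R, (0 < r)%R /\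
      forall eps : R, (0 < eps)%R ->
        eventually (fun n =>
          forall z, disk z -> (Cmod (z - z0) < r)%R ->
            (Cmod (iterate n f z - tau) < eps)%R).

Definition parabolic (f : C -> C) (tau : C) : Prop :=
  holomorphic_self_map f /\ Cmod tau = 1%R /\
  iterates_converge_locally_uniformly f tau /\
  is_angular_derivative f tau 1.

(* artanh of the pseudo-hyperbolic distance, i.e. the distance of the metric
   |dz| / (1 - |z|^2). *)
Definition hyp_dist (z w : C) : R :=
  let t := Cmod ((z - w) / (1 - Cconj w * z)) in
  (ln ((1 + t) / (1 - t)) / 2)%R.

Definition zero_hyperbolic_step (f : C -> C) : Prop :=
  forall z, disk z ->
    is_lim_seq (fun n => hyp_dist (iterate n f z) (iterate (S n) f z)) 0%R.

Definition positive_hyperbolic_step (f : C -> C) : Prop :=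
  forall z, disk z ->
    exists l : R, (0 < l)%R /\
      is_lim_seq (fun n => hyp_dist (iterate n f z) (iterate (S n) f z)) l.

Definition absorbing (f : C -> C) (W : C -> Prop) : Prop :=
  domain W /\ subset W disk /\
  (forall z, W z -> W (f z)) /\
  (forall z, disk z -> exists n : nat, W (iterate n f z)).

Definition koenigs_normalization
    (f h : C -> C) (S : C -> Prop) : Prop :=
  (zero_hyperbolic_step f /\ (forall w, S w) /\ h 0 = 0) \/
  (positive_hyperbolic_step f /\
   ((forall w, S w <-> upper_half_plane w) \/
    (forall w, S w <-> lower_half_plane w)) /\
   Re (h 0) = 0%R).

Definition is_koenigs_function (f h : C -> C) : Prop :=
  exists S : C -> Prop,
    koenigs_normalization f h S /\
    holomorphic_on disk h /\
    (forall z, disk z -> S (h z)) /\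
    (forall z, disk z -> h (f z) = h z + 1) /\
    (forall w, S w <->
       exists (n : nat) (z : C), disk z /\ w = h z - RtoC (INR n)) /\
    (exists W : C -> Prop, absorbing f W /\ injective_on W h).

(* Main.v *)
(* Both [phi o psi] and [psi o phi] satisfy [h o f = h + c1 + c2], and both
   differ from the identity by [o(|z - tau|)] in Stolz angles at [tau], because
   the angular derivatives are [1]. So on the radius near [tau] both have values
   in [V], where [h] is injective; they agree there, hence on the disk by the
   identity theorem. For the Koenigs function one only knows injectivity on an
   absorbing domain, which gives
   [phi^n o (phi o psi) = phi^n o (psi o phi)] near [0], hence on the disk, and
   [phi^n] is injective at the relevant points near [tau], being there a
   small Lipschitz perturbation of the identity.

   The function theory rests on Goursat's theorem for rectangles. In the
   coordinate [log (z - b)] it yields the Cauchy estimate for [f'(b)]; applied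
   to difference quotients, this gives a second derivative, so a zero of [f] can
   be divided out with a bound growing by a constant factor, and accumulating
   zeros force [f = 0]. *)
Require Import Defs.
From Stdlib Require Import Reals Lra Lia ClassicalEpsilon.
From Coquelicot Require Import Coquelicot.
Open Scope C_scope.

(** An absorbing domain is only known to swallow orbits, and orbits may approach [tau] tangentially,
    so it need not contain points of the radius near [tau]. This forces the detour through a
    neighbourhood of [0], where one [n] carries the values of both compositions into the domain.
    That [n] is fixed before [phi^n] is compared with the identity near [tau], because the scale of
    the comparison depends on [n]. In the Cauchy theory the size of the constants is immaterial:
    zeros are divided out repeatedly on one and the same disk, each division costs a factor [8 / r],
    and on a smaller concentric disk the resulting geometric bound tends to zero. Hence a Cauchy
    inequality with a lossy constant is enough, and the logarithmic coordinate supplies one: it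
    turns circles into vertical segments, so that all integrals run along sides of rectangles. *)

(** * Goursat's theorem *)

Section Bisection.
Local Open Scope R_scope.

(** Some quarter of a rectangle carries at least a quarter of the value of [N]. After [n] bisections
    [N a b c d] is at most [4 ^ n] times the value on the current rectangle, while the squared size
    has shrunk exactly by [4 ^ n]; smallness of second order at the common point of all these
    rectangles then excludes a positive value. *)
Lemma bisect_rectangle_zero (N : R -> R -> R -> R -> R) (a b c d : R) :
  a <= b -> c <= d ->
  (forall a' b' c' d', a <= a' -> a' <= b' -> b' <= b ->
     c <= c' -> c' <= d' -> d' <= d ->
     let m := (a' + b') / 2 in let n := (c' + d') / 2 in
     N a' b' c' d' <= N a' m c' n + N m b' c' n + N a' m n d' + N m b' n d') ->
  (forall x y eps, a <= x <= b -> c <= y <= d -> 0 < eps ->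
     exists delta, 0 < delta /\
       forall a' b' c' d', a <= a' <= x -> x <= b' <= b ->
         c <= c' <= y -> y <= d' <= d ->
         b' - a' < delta -> d' - c' < delta ->
         N a' b' c' d' <= eps * ((b' - a') + (d' - c')) ^ 2) ->
  N a b c d <= 0.
Proof.
intros Hab Hcd Hsub Hloc.
destruct (Rle_lt_dec (N a b c d) 0) as [H0|Hpos]; [exact H0|exfalso].
set (w := fun n : nat => (b - a) / 2 ^ n).
set (h := fun n : nat => (d - c) / 2 ^ n).
assert (p2 : forall n : nat, 0 < 2 ^ n) by (intros n; apply pow_lt; lra).
assert (wS : forall n, w n = 2 * w (S n)).
{ intros n; unfold w; simpl; field. apply Rgt_not_eq, p2. }
assert (hS : forall n, h n = 2 * h (S n)).
{ intros n; unfold h; simpl; field. apply Rgt_not_eq, p2. }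
assert (w0 : forall n, 0 <= w n).
{ intros n; unfold w; apply Rmult_le_pos; [lra|]. left; apply Rinv_0_lt_compat, p2. }
assert (h0 : forall n, 0 <= h n).
{ intros n; unfold h; apply Rmult_le_pos; [lra|]. left; apply Rinv_0_lt_compat, p2. }
set (good := fun (n : nat) (p : R * R) =>
  (a <= fst p /\ fst p + w n <= b) /\ (c <= snd p /\ snd p + h n <= d) /\
  N a b c d <= 4 ^ n * N (fst p) (fst p + w n) (snd p) (snd p + h n)).
set (next := fun (n : nat) (p q : R * R) =>
  (fst p <= fst q /\ fst q + w (S n) <= fst p + w n) /\
  (snd p <= snd q /\ snd q + h (S n) <= snd p + h n)).
assert (step : forall n p, good n p -> exists q, good (S n) q /\ next n p q).
{ intros n [x y] [[G1 G2] [[G3 G4] G5]]; simpl in *.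
  pose proof (w0 n); pose proof (h0 n). pose proof (w0 (S n)); pose proof (h0 (S n)).
  pose proof (wS n); pose proof (hS n).
  pose proof (Hsub x (x + w n) y (y + h n) G1 ltac:(lra) G2 G3 ltac:(lra) G4) as Q.
  cbv zeta in Q.
  replace ((x + (x + w n)) / 2) with (x + w (S n)) in Q by lra.
  replace ((y + (y + h n)) / 2) with (y + h (S n)) in Q by lra.
  set (M := N x (x + w n) y (y + h n)) in *.
  assert (Hch : exists q : R * R, (fst q = x \/ fst q = x + w (S n)) /\
     (snd q = y \/ snd q = y + h (S n)) /\
     M <= 4 * N (fst q) (fst q + w (S n)) (snd q) (snd q + h (S n))).
  { replace (x + w n) with (x + w (S n) + w (S n)) in Q by lra.
    replace (y + h n) with (y + h (S n) + h (S n)) in Q by lra.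
    destruct (Rle_lt_dec M (4 * N x (x + w (S n)) y (y + h (S n)))).
    { exists (x, y); simpl; auto. }
    destruct (Rle_lt_dec M (4 * N (x + w (S n)) (x + w (S n) + w (S n)) y (y + h (S n)))).
    { exists (x + w (S n), y); simpl; auto. }
    destruct (Rle_lt_dec M (4 * N x (x + w (S n)) (y + h (S n)) (y + h (S n) + h (S n)))).
    { exists (x, y + h (S n)); simpl; auto. }
    exists (x + w (S n), y + h (S n)); simpl. repeat split; auto. lra. }
  destruct Hch as [q [Hx [Hy HM]]]. exists q.
  pose proof (pow_lt 4 n ltac:(lra)).
  assert (N a b c d <= 4 ^ S n * N (fst q) (fst q + w (S n)) (snd q) (snd q + h (S n))).
  { apply Rle_trans with (1 := G5). simpl. rewrite (Rmult_comm 4), Rmult_assoc.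
    apply Rmult_le_compat_l; lra. }
  unfold good, next; simpl in *. destruct Hx, Hy; repeat split; lra. }
(* The lower left corners of the nested rectangles, each chosen by [epsilon]; [step] guarantees that
   a choice exists as long as the previous corner is good. *)
set (st := fix st n : R * R := match n with
  | O => (a, c)
  | S k => epsilon (inhabits (a, c)) (fun q => good (S k) q /\ next k (st k) q) end).
assert (Hg : forall n, good n (st n)).
{ induction n as [|n IH].
  - unfold good, w, h; simpl. rewrite !Rdiv_1_r. replace (a + (b - a)) with b by ring.
    replace (c + (d - c)) with d by ring. repeat split; lra.
  - apply (epsilon_spec (inhabits (a, c)) _ (step n _ IH)). }
assert (Hn : forall n, next n (st n) (st (S n))).
{ intros n. apply (epsilon_spec (inhabits (a, c)) _ (step n _ (Hg n))). }
assert (mono : forall n k, (fst (st n) <= fst (st (n + k)%nat) /\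
   fst (st (n + k)%nat) + w (n + k)%nat <= fst (st n) + w n) /\
   (snd (st n) <= snd (st (n + k)%nat) /\
   snd (st (n + k)%nat) + h (n + k)%nat <= snd (st n) + h n)).
{ intros n; induction k as [|k IH].
  - rewrite Nat.add_0_r; lra.
  - rewrite Nat.add_succ_r. pose proof (Hn (n + k)%nat) as Q; unfold next in Q. lra. }
(* Every left or lower end lies below every right or upper end, whatever the two stages;
   completeness then yields a point common to all rectangles. *)
assert (cross : forall n m, fst (st n) <= fst (st m) + w m /\ snd (st n) <= snd (st m) + h m).
{ intros n m. destruct (Nat.le_ge_cases n m) as [L|L].
  - replace m with (n + (m - n))%nat by lia.
    pose proof (mono n (m - n)%nat). pose proof (w0 (n + (m - n))%nat).
    pose proof (h0 (n + (m - n))%nat). lra.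
  - replace n with (m + (n - m))%nat by lia.
    pose proof (mono m (n - m)%nat). pose proof (w0 (m + (n - m))%nat).
    pose proof (h0 (m + (n - m))%nat). lra. }
assert (lim : forall u v : nat -> R, (forall n m, u n <= v m) ->
   exists l, forall n, u n <= l <= v n).
{ intros u v Huv.
  destruct (completeness (fun r => exists n, r = u n)) as [l [L1 L2]].
  - exists (v O). intros r [n ->]; apply Huv.
  - exists (u O), O; reflexivity.
  - exists l; intros n; split; [apply L1; now exists n|].
    apply L2. intros r [k ->]; apply Huv. }
destruct (lim (fun n => fst (st n)) (fun n => fst (st n) + w n)) as [px Hpx];
  [intros; apply cross|].
destruct (lim (fun n => snd (st n)) (fun n => snd (st n) + h n)) as [py Hpy];
  [intros; apply cross|]. simpl in *.
set (D := (b - a) + (d - c)).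
assert (D0 : 0 <= D) by (unfold D; lra).
(* Chosen so that [eps * (D + 1) ^ 2] is half of [N a b c d]; [D + 1] replaces [D] because the
   rectangle may be degenerate. *)
set (eps := N a b c d / (2 * (D + 1) ^ 2)).
assert (D2 : 0 < (D + 1) ^ 2) by (apply pow_lt; lra).
assert (He : 0 < eps) by (unfold eps; apply Rdiv_lt_0_compat; lra).
assert (Hin : forall n, (a <= fst (st n) /\ fst (st n) + w n <= b) /\
   (c <= snd (st n) /\ snd (st n) + h n <= d)) by (intros n; split; apply (Hg n)).
destruct (Hloc px py eps) as [del [Hd Hdel]].
{ pose proof (Hpx O); pose proof (Hin O); lra. }
{ pose proof (Hpy O); pose proof (Hin O); lra. }
{ exact He. }
assert (exists n, (D + 1) / 2 ^ n < del) as [n Hsmall].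
{ destruct (pow_lt_1_zero (/ 2) ltac:(rewrite Rabs_pos_eq; lra) (del / (D + 1))) as [n Q].
  { apply Rdiv_lt_0_compat; lra. }
  exists n. specialize (Q n (le_n n)). rewrite Rabs_pos_eq, pow_inv in Q.
  2: apply pow_le; lra.
  apply Rmult_lt_compat_l with (r := D + 1) in Q; [|lra].
  replace ((D + 1) * (del / (D + 1))) with del in Q by (field; lra). exact Q. }
assert (Hw : w n + h n <= (D + 1) / 2 ^ n).
{ unfold w, h. rewrite <- Rdiv_plus_distr. apply Rmult_le_compat_r.
  left; apply Rinv_0_lt_compat, p2. unfold D; lra. }
pose proof (w0 n); pose proof (h0 n). pose proof (Hin n). pose proof (Hpx n). pose proof (Hpy n).
assert (Q : N (fst (st n)) (fst (st n) + w n) (snd (st n)) (snd (st n) + h n)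
   <= eps * (w n + h n) ^ 2).
{ eapply Rle_trans. apply Hdel; lra. right. ring. }
destruct (Hg n) as [_ [_ G]].
assert (E4 : 4 ^ n = 2 ^ n * 2 ^ n) by (rewrite <- Rpow_mult_distr; f_equal; lra).
assert (Hsq : 4 ^ n * (w n + h n) ^ 2 <= (D + 1) ^ 2).
{ rewrite E4. replace (2 ^ n * 2 ^ n * (w n + h n) ^ 2) with ((2 ^ n * (w n + h n)) ^ 2) by ring.
  apply pow_incr. split. apply Rmult_le_pos; [left; apply p2|lra].
  replace (D + 1) with (2 ^ n * ((D + 1) / 2 ^ n)) by (field; apply Rgt_not_eq, p2).
  apply Rmult_le_compat_l; [left; apply p2|lra]. }
assert (N a b c d <= eps * (D + 1) ^ 2).
{ eapply Rle_trans; [exact G|].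
  eapply Rle_trans. apply Rmult_le_compat_l. apply pow_le; lra. exact Q.
  replace (4 ^ n * (eps * (w n + h n) ^ 2)) with (eps * (4 ^ n * (w n + h n) ^ 2)) by ring.
  apply Rmult_le_compat_l; lra. }
unfold eps in H4. replace (N a b c d / (2 * (D + 1) ^ 2) * (D + 1) ^ 2) with (N a b c d / 2) in H4.
lra. field. lra.
Qed.
End Bisection.
(* Coquelicot's [is_derive] over [C] uses two different uniform structures on
   [C]; this epsilon-delta form avoids them. *)
Definition cderiv (f : C -> C) (z l : C) : Prop :=
  forall eps : R, (0 < eps)%R -> exists delta : R, (0 < delta)%R /\
    forall w, (Cmod (w - z) < delta)%R ->
      (Cmod (f w - f z - l * (w - z)) <= eps * Cmod (w - z))%R.

(** * Modulus inequalities and the calculus of complex derivatives *)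

Lemma Cmod_minus_sym (z w : C) : Cmod (z - w) = Cmod (w - z).
Proof. rewrite <- Cmod_opp. f_equal. ring. Qed.

Lemma Cmod_minus_0 (z : C) : Cmod (z - z) = 0%R.
Proof. replace (z - z) with (RtoC 0) by ring. apply Cmod_0. Qed.

Lemma Cmod_triangle_minus (z w : C) : (Cmod (z - w) <= Cmod z + Cmod w)%R.
Proof. rewrite <- (Cmod_opp w). apply Cmod_triangle. Qed.

Lemma Cmod_chain (z u w : C) : (Cmod (z - w) <= Cmod (z - u) + Cmod (u - w))%R.
Proof. replace (z - w) with ((z - u) + (u - w)) by ring. apply Cmod_triangle. Qed.

Lemma Cmod_le_plus_minus (z w : C) : (Cmod z <= Cmod w + Cmod (z - w))%R.
Proof.
replace z with (w + (z - w)) at 1 by ring. apply Cmod_triangle.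
Qed.

Lemma ex_derive_cderiv (f : C -> C) (z : C) :
  @ex_derive C_AbsRing C_NormedModule f z -> exists l, cderiv f z l.
Proof.
intros [l [_ H]]. exists l. intros eps He.
specialize (H z (fun P HP => HP) (mkposreal eps He)).
destruct H as [d Hd]. exists d; split; [apply cond_pos|]. intros w Hw.
specialize (Hd w Hw). simpl in Hd.
change (Cmod ((f w - f z) - (w - z) * l) <= eps * Cmod (w - z))%R in Hd.
rewrite (Cmult_comm l). exact Hd.
Qed.

Lemma cderiv_ext_loc (f g : C -> C) (z l : C) (rho : R) :
  (0 < rho)%R ->
  (forall w, (Cmod (w - z) < rho)%R -> f w = g w) -> cderiv f z l -> cderiv g z l.
Proof.
intros Hr E H eps He. destruct (H eps He) as [d [Hd Hw]].
exists (Rmin d rho). split; [now apply Rmin_pos|]. intros w Q.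
rewrite <- !E. apply Hw. eapply Rlt_le_trans; [exact Q|apply Rmin_l].
rewrite Cmod_minus_0; exact Hr.
eapply Rlt_le_trans; [exact Q|apply Rmin_r].
Qed.

Lemma cderiv_continuous (f : C -> C) (z l : C) :
  cderiv f z l -> forall eps : R, (0 < eps)%R -> exists delta : R, (0 < delta)%R /\
    forall w, (Cmod (w - z) < delta)%R -> (Cmod (f w - f z) < eps)%R.
Proof.
intros H eps He. destruct (H 1%R Rlt_0_1) as [d [Hd Hw]].
pose proof (Cmod_ge_0 l) as Hl.
exists (Rmin d (eps / (Cmod l + 2))). split.
{ apply Rmin_pos; [exact Hd|]. apply Rdiv_lt_0_compat; lra. }
intros w Q. specialize (Hw w (Rlt_le_trans _ _ _ Q (Rmin_l _ _))).
pose proof (Rlt_le_trans _ _ _ Q (Rmin_r _ _)) as Q2.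
pose proof (Cmod_le_plus_minus (f w - f z) (l * (w - z))) as T. rewrite Cmod_mult in T.
pose proof (Cmod_ge_0 (w - z)).
apply (Rmult_lt_compat_l (Cmod l + 2)) in Q2; [|lra].
replace ((Cmod l + 2) * (eps / (Cmod l + 2)))%R with eps in Q2 by (field; lra). nra.
Qed.

Lemma cderiv_linear (a b z : C) : cderiv (fun w => a * w + b) z a.
Proof.
intros eps He. exists 1%R; split; [lra|]. intros w _.
replace (a * w + b - (a * z + b) - a * (w - z)) with (RtoC 0) by ring.
rewrite Cmod_0. apply Rmult_le_pos; [lra|apply Cmod_ge_0].
Qed.

Lemma cderiv_const (a z : C) : cderiv (fun _ => a) z 0.
Proof.
intros eps He. exists 1%R; split; [lra|]. intros w _.
replace (a - a - 0 * (w - z)) with (RtoC 0) by ring.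
rewrite Cmod_0. apply Rmult_le_pos; [lra|apply Cmod_ge_0].
Qed.

Lemma cderiv_id (z : C) : cderiv (fun w => w) z 1.
Proof.
intros eps He. exists 1%R; split; [lra|]. intros w _.
replace (w - z - 1 * (w - z)) with (RtoC 0) by ring.
rewrite Cmod_0. apply Rmult_le_pos; [lra|apply Cmod_ge_0].
Qed.

Lemma cderiv_opp (z : C) : cderiv Copp z (- (1)).
Proof.
intros eps He. exists 1%R; split; [lra|]. intros w _.
replace (- w - - z - - (1) * (w - z)) with (RtoC 0) by ring.
rewrite Cmod_0. apply Rmult_le_pos; [lra|apply Cmod_ge_0].
Qed.

Lemma cderiv_plus (f g : C -> C) (z l m : C) :
  cderiv f z l -> cderiv g z m -> cderiv (fun w => f w + g w) z (l + m).
Proof.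
intros Hf Hg eps He.
destruct (Hf (eps / 2)%R ltac:(lra)) as [d [Hd Pf]].
destruct (Hg (eps / 2)%R ltac:(lra)) as [d' [Hd' Pg]].
exists (Rmin d d'); split; [now apply Rmin_pos|]. intros w Q.
specialize (Pf w (Rlt_le_trans _ _ _ Q (Rmin_l _ _))).
specialize (Pg w (Rlt_le_trans _ _ _ Q (Rmin_r _ _))).
replace (f w + g w - (f z + g z) - (l + m) * (w - z)) with
  ((f w - f z - l * (w - z)) + (g w - g z - m * (w - z))) by ring.
eapply Rle_trans; [apply Cmod_triangle|]. lra.
Qed.

Lemma cderiv_comp (f g : C -> C) (z l m : C) :
  cderiv f (g z) l -> cderiv g z m -> cderiv (fun w => f (g w)) z (l * m).
Proof.
intros Hf Hg eps He.
pose proof (Cmod_ge_0 l) as Hl. pose proof (Cmod_ge_0 m) as Hm.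
set (e1 := (eps / (2 * (Cmod m + 1)))%R).
assert (He1 : (0 < e1)%R) by (apply Rdiv_lt_0_compat; lra).
(* The bound [e2 <= 1] gives [|g w - g z| <= (|m| + 1) r], against which [e1] is calibrated; the
   other bound controls the error of [g] multiplied by [l]. *)
set (e2 := Rmin 1 (eps / (2 * (Cmod l + 1)))).
assert (He2 : (0 < e2)%R) by (apply Rmin_pos; [lra|apply Rdiv_lt_0_compat; lra]).
destruct (Hf e1 He1) as [d1 [Hd1 P1]].
destruct (Hg e2 He2) as [d2 [Hd2 P2]].
destruct (cderiv_continuous g z m Hg d1 Hd1) as [d3 [Hd3 P3]].
exists (Rmin d2 d3); split; [now apply Rmin_pos|]. intros w Q.
specialize (P2 w (Rlt_le_trans _ _ _ Q (Rmin_l _ _))).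
specialize (P3 w (Rlt_le_trans _ _ _ Q (Rmin_r _ _))).
specialize (P1 (g w) P3).
pose proof (Cmod_ge_0 (w - z)) as H0.
set (r := Cmod (w - z)) in *.
replace (f (g w) - f (g z) - l * m * (w - z)) with
  ((f (g w) - f (g z) - l * (g w - g z)) + l * (g w - g z - m * (w - z))) by ring.
eapply Rle_trans; [apply Cmod_triangle|]. rewrite Cmod_mult.
assert (G : (Cmod (g w - g z) <= (Cmod m + 1) * r)%R).
{ eapply Rle_trans; [apply (Cmod_le_plus_minus _ (m * (w - z)))|]. rewrite Cmod_mult. fold r.
  assert (e2 <= 1)%R by apply Rmin_l. nra. }
assert (A1 : (e1 * Cmod (g w - g z) <= eps / 2 * r)%R).
{ eapply Rle_trans; [apply Rmult_le_compat_l; [lra|exact G]|]. right. unfold e1. field. lra. }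
assert (A2 : (Cmod l * Cmod (g w - g z - m * (w - z)) <= eps / 2 * r)%R).
{ eapply Rle_trans; [apply Rmult_le_compat_l; [exact Hl|exact P2]|].
  assert (E : (e2 <= eps / (2 * (Cmod l + 1)))%R) by apply Rmin_r.
  assert ((Cmod l * e2 <= eps / 2)%R).
  { eapply Rle_trans; [apply Rmult_le_compat_l; [exact Hl|exact E]|].
    replace (eps / 2)%R with ((Cmod l + 1) * (eps / (2 * (Cmod l + 1))))%R by (field; lra).
    apply Rmult_le_compat_r; [|lra]. left; apply Rdiv_lt_0_compat; lra. }
  rewrite <- Rmult_assoc. now apply Rmult_le_compat_r. }
lra.
Qed.

Lemma cderiv_square (z : C) : cderiv (fun w => w * w) z (2 * z).
Proof.
intros eps He. exists eps; split; [exact He|]. intros w Q.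
replace (w * w - z * z - 2 * z * (w - z)) with ((w - z) * (w - z)) by ring.
rewrite Cmod_mult. apply Rmult_le_compat_r; [apply Cmod_ge_0|lra].
Qed.

Lemma cderiv_scal (f : C -> C) (a z l : C) : cderiv f z l -> cderiv (fun w => a * f w) z (a * l).
Proof.
intros H. assert (E := cderiv_comp (fun w => a * w + 0) f z a l (cderiv_linear _ _ _) H).
intros eps He. destruct (E eps He) as [d [Hd P]]. exists d; split; [exact Hd|].
intros w Q. replace (a * f w - a * f z) with (a * f w + 0 - (a * f z + 0)) by ring. now apply P.
Qed.

Lemma cderiv_minus (f g : C -> C) (z l m : C) :
  cderiv f z l -> cderiv g z m -> cderiv (fun w => f w - g w) z (l - m).
Proof.
intros Hf Hg. pose proof (cderiv_plus _ _ _ _ _ Hf (cderiv_scal _ (-(1)) _ _ Hg)) as E.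
intros eps He. destruct (E eps He) as [d [Hd P]]. exists d; split; [exact Hd|].
intros w Q. specialize (P w Q).
replace (f w - g w - (f z - g z) - (l - m) * (w - z)) with
 (f w + - (1) * g w - (f z + - (1) * g z) - (l + - (1) * m) * (w - z)) by ring. exact P.
Qed.

(* Polarization reduces the product rule to the chain rule for the square. *)
Lemma cderiv_mult (f g : C -> C) (z l m : C) :
  cderiv f z l -> cderiv g z m -> cderiv (fun w => f w * g w) z (l * g z + f z * m).
Proof.
intros Hf Hg.
pose proof (cderiv_comp _ _ _ _ _ (cderiv_square _) (cderiv_plus _ _ _ _ _ Hf Hg)) as P.
pose proof (cderiv_comp _ _ _ _ _ (cderiv_square _) (cderiv_minus _ _ _ _ _ Hf Hg)) as M.
pose proof (cderiv_scal _ (/ 4) _ _ (cderiv_minus _ _ _ _ _ P M)) as E.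
intros eps He. destruct (E eps He) as [d [Hd Q]]. exists d; split; [exact Hd|].
intros w Hw. specialize (Q w Hw). simpl in Q.
replace (f w * g w - f z * g z - (l * g z + f z * m) * (w - z)) with
  (/ 4 * ((f w + g w) * (f w + g w) - (f w - g w) * (f w - g w)) -
   / 4 * ((f z + g z) * (f z + g z) - (f z - g z) * (f z - g z)) -
   / 4 * (2 * (f z + g z) * (l + m) - 2 * (f z - g z) * (l - m)) * (w - z)); [exact Q|].
field.
Qed.

Lemma cderiv_inv (z : C) : z <> 0 -> cderiv (fun w => / w) z (- / (z * z)).
Proof.
intros Hz eps He.
assert (Hm : (0 < Cmod z)%R) by now apply Cmod_gt_0.
set (m := Cmod z) in *.
(* The remainder is [(w - z)^2 / (z^2 w)], and [|w| > m / 2] on this disk, so its modulus is at most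
   [2 |w - z|^2 / m^3]. *)
exists (Rmin (m / 2) (eps * m ^ 3 / 2)). split.
{ apply Rmin_pos; [lra|]. pose proof (pow_lt m 3 Hm). apply Rdiv_lt_0_compat; nra. }
intros w Q.
pose proof (Rlt_le_trans _ _ _ Q (Rmin_l _ _)) as Q1.
pose proof (Rlt_le_trans _ _ _ Q (Rmin_r _ _)) as Q2.
assert (Hw : (m / 2 < Cmod w)%R).
{ pose proof (Cmod_le_plus_minus z w) as T. rewrite Cmod_minus_sym in T. unfold m in *; lra. }
assert (w <> 0) by (apply Cmod_gt_0; lra).
replace (/ w - / z - - / (z * z) * (w - z)) with ((w - z) * (w - z) / (z * z * w)) by (field; auto).
rewrite Cmod_div, !Cmod_mult by (repeat apply Cmult_neq_0; auto). fold m.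
pose proof (Cmod_ge_0 (w - z)) as H0. set (r := Cmod (w - z)) in *.
set (c := Cmod w) in *.
assert (Hmc : (0 < m * m * c)%R) by (repeat apply Rmult_lt_0_compat; lra).
apply Rle_div_l; [exact Hmc|].
replace (eps * r * (m * m * c))%R with (r * (eps * (m * m * c)))%R by ring.
apply Rmult_le_compat_l; [exact H0|].
assert (m * m * (m / 2) <= m * m * c)%R by (apply Rmult_le_compat_l; nra). nra.
Qed.

(** The way back to Coquelicot's derivative in a real variable, which its integration theory uses.
    The path has constant velocity [u]; dividing by [Cmod u + 1] keeps the estimates valid for
    [u = 0]. *)
Lemma cderiv_path (f : C -> C) (gamma : R -> C) (t : R) (u l : C) :
  (forall s, gamma s = gamma t + (s - t)%R * u) -> cderiv f (gamma t) l ->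
  @is_derive R_AbsRing C_R_NormedModule (fun s => f (gamma s)) t (u * l).
Proof.
intros Hg H. split; [apply (@is_linear_scal_l R_AbsRing C_R_NormedModule)|].
intros x Hx. apply (is_filter_lim_locally_unique (V := R_NormedModule)) in Hx. subst x.
intros [eps He]. simpl.
pose proof (Cmod_ge_0 u) as Hu.
destruct (H (eps / (Cmod u + 1))%R) as [d [Hd P]]; [apply Rdiv_lt_0_compat; lra|].
assert (Hd' : (0 < d / (Cmod u + 1))%R) by (apply Rdiv_lt_0_compat; lra).
exists (mkposreal _ Hd'). intros s Hs. simpl in Hs.
change (Rabs (s - t) < d / (Cmod u + 1))%R in Hs.
change (@norm R_AbsRing C_R_NormedModule) with
  (@norm R_AbsRing (prod_NormedModule R_AbsRing R_NormedModule R_NormedModule)).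
rewrite <- Cmod_norm.
change (Cmod ((f (gamma s) - f (gamma t)) - @scal R_AbsRing C_R_NormedModule (s - t)%R (u * l)%C)%C <=
   eps * Rabs (s - t))%R.
rewrite scal_R_Cmult.
assert (E : gamma s - gamma t = (s - t)%R * u) by (rewrite (Hg s); ring).
assert (En : Cmod (gamma s - gamma t) = (Rabs (s - t) * Cmod u)%R)
  by (rewrite E, Cmod_mult, Cmod_R; reflexivity).
pose proof (Rabs_pos (s - t)) as Ha.
replace ((s - t)%R * (u * l)) with (l * (gamma s - gamma t)) by (rewrite E; ring).
eapply Rle_trans; [apply P|].
- rewrite En. apply Rle_lt_trans with (Rabs (s - t) * (Cmod u + 1))%R; [nra|].
  apply Rlt_div_r in Hs; lra.
- rewrite En. replace (eps * Rabs (s - t))%R with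
   (eps / (Cmod u + 1) * (Rabs (s - t) * (Cmod u + 1)))%R by (field; lra).
  apply Rmult_le_compat_l; [left; apply Rdiv_lt_0_compat; lra|nra].
Qed.

(** * Contour integrals along segments and around rectangles *)

(** The contour integral of [g] from [z + a u] to [z + b u]; the velocity [u] stands in the
    integrand, and [C] is taken as a real normed module so that [RInt] applies. *)
Definition seg (g : C -> C) (z u : C) (a b : R) : C :=
  @RInt C_R_CompleteNormedModule (fun t : R => u * g (z + t * u)) a b.

Lemma cderiv_along (f : C -> C) (z u l : C) (t : R) :
  cderiv f (z + t * u) l ->
  @is_derive R_AbsRing C_R_NormedModule (fun s : R => f (z + s * u)) t (u * l).
Proof.
intros H. apply (cderiv_path f (fun s : R => z + s * u)); [|exact H].
intros s. rewrite RtoC_minus. ring.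
Qed.

Lemma seg_integrable (g : C -> C) (z u : C) (a b : R) :
  (a <= b)%R ->
  (forall t : R, (a <= t <= b)%R -> exists l, cderiv g (z + t * u) l) ->
  @ex_RInt C_R_CompleteNormedModule (fun t : R => u * g (z + t * u)) a b.
Proof.
intros Hab H. apply (@ex_RInt_continuous C_R_CompleteNormedModule).
intros t Ht. rewrite Rmin_left, Rmax_right in Ht by lra.
destruct (H t Ht) as [l Hl].
apply (@ex_derive_continuous R_AbsRing C_R_NormedModule).
eexists. apply (cderiv_along (fun w => u * g w)), cderiv_scal, Hl.
Qed.

Lemma seg_correct (g : C -> C) (z u : C) (a b : R) :
  (a <= b)%R ->
  (forall t : R, (a <= t <= b)%R -> exists l, cderiv g (z + t * u) l) ->
  @is_RInt C_R_NormedModule (fun t : R => u * g (z + t * u)) a b (seg g z u a b).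
Proof.
intros Hab H. apply (@RInt_correct C_R_CompleteNormedModule), seg_integrable; assumption.
Qed.

Lemma seg_Chasles (g : C -> C) (z u : C) (a b c : R) :
  (a <= b <= c)%R ->
  (forall t : R, (a <= t <= c)%R -> exists l, cderiv g (z + t * u) l) ->
  seg g z u a c = seg g z u a b + seg g z u b c.
Proof.
intros Habc H. symmetry. apply (@RInt_Chasles C_R_CompleteNormedModule).
- apply seg_integrable; [lra|]. intros t Ht; apply H; lra.
- apply seg_integrable; [lra|]. intros t Ht; apply H; lra.
Qed.

Lemma seg_bound (g : C -> C) (z u : C) (a b M : R) :
  (a <= b)%R ->
  (forall t : R, (a <= t <= b)%R -> exists l, cderiv g (z + t * u) l) ->
  (forall t : R, (a <= t <= b)%R -> (Cmod (g (z + t * u)%C) <= M)%R) ->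
  (Cmod (seg g z u a b) <= (b - a) * (Cmod u * M))%R.
Proof.
intros Hab H HM. rewrite Cmod_norm.
apply (@norm_RInt_le_const C_R_NormedModule (fun t : R => u * g (z + t * u)) a b); [exact Hab| |].
- intros t Ht. change (@norm R_AbsRing C_R_NormedModule) with
  (@norm R_AbsRing (prod_NormedModule R_AbsRing R_NormedModule R_NormedModule)).
  rewrite <- Cmod_norm, Cmod_mult. apply Rmult_le_compat_l; [apply Cmod_ge_0|auto].
- apply seg_correct; assumption.
Qed.

Lemma seg_minus (g q : C -> C) (z u : C) (a b : R) :
  (a <= b)%R ->
  (forall t : R, (a <= t <= b)%R -> exists l, cderiv g (z + t * u) l) ->
  (forall t : R, (a <= t <= b)%R -> exists l, cderiv q (z + t * u) l) ->
  seg (fun w => g w - q w) z u a b = seg g z u a b - seg q z u a b.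
Proof.
intros Hab Hg Hq. unfold seg at 1.
apply (@is_RInt_unique C_R_CompleteNormedModule).
eapply (@is_RInt_ext C_R_NormedModule).
2: apply (@is_RInt_minus C_R_NormedModule); [exact (seg_correct g z u a b Hab Hg)|
     exact (seg_correct q z u a b Hab Hq)].
intros t _. change (u * g (z + t * u) - u * q (z + t * u) = u * (g (z + t * u) - q (z + t * u))).
ring.
Qed.

Lemma seg_primitive (G g : C -> C) (z u : C) (a b : R) :
  (a <= b)%R ->
  (forall t : R, (a <= t <= b)%R -> cderiv G (z + t * u) (g (z + t * u))) ->
  (forall t : R, (a <= t <= b)%R -> exists l, cderiv g (z + t * u) l) ->
  seg g z u a b = G (z + b * u) - G (z + a * u).
Proof.
intros Hab HG Hg. unfold seg. apply (@is_RInt_unique C_R_CompleteNormedModule).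
apply (@is_RInt_derive C_R_CompleteNormedModule (fun t : R => G (z + t * u))).
- intros t Ht. rewrite Rmin_left, Rmax_right in Ht by lra. apply cderiv_along, HG, Ht.
- intros t Ht. rewrite Rmin_left, Rmax_right in Ht by lra. destruct (Hg t Ht) as [l Hl].
  apply (@ex_derive_continuous R_AbsRing C_R_NormedModule).
  eexists. apply (cderiv_along (fun w => u * g w)), cderiv_scal, Hl.
Qed.

(** The counterclockwise boundary integral, in the order bottom, top, right, left. Every side is
    parametrized increasingly, hence the minus signs at the top and left sides. *)
Definition rectangle_integral (g : C -> C) (a b c d : R) : C :=
  seg g (c * Ci) 1 a b - seg g (d * Ci) 1 a b + seg g b Ci c d - seg g a Ci c d.

Definition differentiable_on_rectangle (g : C -> C) (a b c d : R) : Prop :=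
  forall s t : R, (a <= s <= b)%R -> (c <= t <= d)%R -> exists l, cderiv g (s + t * Ci) l.

Lemma horizontal_differentiable (g : C -> C) (a b c d t : R) :
  differentiable_on_rectangle g a b c d -> (c <= t <= d)%R ->
  forall s : R, (a <= s <= b)%R -> exists l, cderiv g (t * Ci + s * 1) l.
Proof.
intros H Ht s Hs. replace (t * Ci + s * 1) with (s + t * Ci) by ring. now apply H.
Qed.

Lemma differentiable_on_subrectangle (g : C -> C) (a b c d a' b' c' d' : R) :
  differentiable_on_rectangle g a b c d ->
  (a <= a')%R -> (b' <= b)%R -> (c <= c')%R -> (d' <= d)%R ->
  differentiable_on_rectangle g a' b' c' d'.
Proof. intros H ? ? ? ? s t Hs Ht. apply H; lra. Qed.

(** An affine function has the primitive [l / 2 * w^2 + m * w], whose values at the four corners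
    cancel. *)
Lemma rectangle_integral_linear (l m : C) (a b c d : R) :
  (a <= b)%R -> (c <= d)%R -> rectangle_integral (fun w => l * w + m) a b c d = 0.
Proof.
intros Hab Hcd. unfold rectangle_integral.
assert (D : forall z, cderiv (fun w => l / 2 * (w * w) + (m * w + 0)) z (l * z + m)).
{ intros z. replace (l * z + m) with (l / 2 * (2 * z) + m) by field.
  apply cderiv_plus; [apply cderiv_scal, cderiv_square|apply cderiv_linear]. }
assert (E : forall z, exists k, cderiv (fun w => l * w + m) z k)
  by (intros z; eexists; apply cderiv_linear).
rewrite !(seg_primitive (fun w => l / 2 * (w * w) + (m * w + 0))); auto.
ring.
Qed.

Lemma rectangle_integral_minus (g q : C -> C) (a b c d : R) :
  (a <= b)%R -> (c <= d)%R ->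
  differentiable_on_rectangle g a b c d -> differentiable_on_rectangle q a b c d ->
  rectangle_integral (fun w => g w - q w) a b c d =
  rectangle_integral g a b c d - rectangle_integral q a b c d.
Proof.
intros Hab Hcd Hg Hq. unfold rectangle_integral.
rewrite !seg_minus; try assumption;
 try (eapply horizontal_differentiable; [eassumption|lra]);
 try (intros t Ht; first [apply Hg|apply Hq]; lra).
ring.
Qed.

Lemma rectangle_integral_bound (g : C -> C) (a b c d M : R) :
  (a <= b)%R -> (c <= d)%R -> differentiable_on_rectangle g a b c d ->
  (forall s t : R, (a <= s <= b)%R -> (c <= t <= d)%R -> (Cmod (g (s + t * Ci)%C) <= M)%R) ->
  (Cmod (rectangle_integral g a b c d) <= 2 * ((b - a) + (d - c)) * M)%R.
Proof.
intros Hab Hcd Hg HM. unfold rectangle_integral.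
assert (HH : forall t, (c <= t <= d)%R -> (Cmod (seg g (t * Ci)%C 1%C a b) <= (b - a) * M)%R).
{ intros t Ht. replace M with (Cmod 1 * M)%R by (rewrite Cmod_1; ring).
  apply seg_bound; [exact Hab| |].
  - eapply horizontal_differentiable; [eassumption|lra].
  - intros s Hs. replace (t * Ci + s * 1) with (s + t * Ci) by ring. now apply HM. }
assert (VV : forall s : R, (a <= s <= b)%R -> (Cmod (seg g s Ci c d) <= (d - c) * M)%R).
{ intros s Hs. replace M with (Cmod Ci * M)%R by (rewrite Cmod_Ci; ring).
  apply seg_bound; [exact Hcd| |]; intros t Ht; [apply Hg|apply HM]; lra. }
pose proof (HH c ltac:(lra)). pose proof (HH d ltac:(lra)).
pose proof (VV a ltac:(lra)). pose proof (VV b ltac:(lra)).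
eapply Rle_trans; [apply Cmod_triangle_minus|].
eapply Rle_trans; [apply Rplus_le_compat_r, Cmod_triangle|].
eapply Rle_trans; [apply Rplus_le_compat_r, Rplus_le_compat_r, Cmod_triangle_minus|]. lra.
Qed.

(** The integrals over the inner segments occur twice with opposite signs. *)
Lemma rectangle_integral_split (g : C -> C) (a b c d m n : R) :
  (a <= m <= b)%R -> (c <= n <= d)%R -> differentiable_on_rectangle g a b c d ->
  rectangle_integral g a b c d =
  rectangle_integral g a m c n + rectangle_integral g m b c n +
  rectangle_integral g a m n d + rectangle_integral g m b n d.
Proof.
intros Hm Hn Hg. unfold rectangle_integral.
rewrite (seg_Chasles g (c * Ci) 1 a m b), (seg_Chasles g (d * Ci) 1 a m b),
  (seg_Chasles g b Ci c n d), (seg_Chasles g a Ci c n d); try assumption;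
 try (eapply horizontal_differentiable; [eassumption|lra]);
 try (intros t Ht; apply Hg; lra).
ring.
Qed.

Lemma Cmod_rectangle (s t x y : R) :
  (Cmod ((s + t * Ci) - (x + y * Ci))%C <= Rabs (s - x) + Rabs (t - y))%R.
Proof.
replace ((s + t * Ci) - (x + y * Ci)) with (RtoC (s - x) + RtoC (t - y) * Ci)
  by (rewrite !RtoC_minus; ring).
eapply Rle_trans; [apply Cmod_triangle|]. rewrite Cmod_mult, Cmod_Ci, !Cmod_R. lra.
Qed.

(** Near [p] the function differs from its tangent [q] by at most [eps / 2 * D] on a rectangle with
    half-perimeter [D]. Since [q] integrates to zero, the boundary integral is at most
    [2 D * (eps / 2 * D)], the second-order smallness that bisection asks for. *)
Lemma goursat (g : C -> C) (a b c d : R) :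
  (a <= b)%R -> (c <= d)%R -> differentiable_on_rectangle g a b c d ->
  rectangle_integral g a b c d = 0.
Proof.
intros Hab Hcd Hg. apply Cmod_eq_0. apply Rle_antisym; [|apply Cmod_ge_0].
apply (bisect_rectangle_zero (fun a b c d => Cmod (rectangle_integral g a b c d))); auto.
- intros a' b' c' d' H1 H2 H3 H4 H5 H6 m n.
  rewrite (rectangle_integral_split g a' b' c' d' m n); unfold m, n; try lra.
  + eapply Rle_trans; [apply Cmod_triangle|]. apply Rplus_le_compat_r.
    eapply Rle_trans; [apply Cmod_triangle|]. apply Rplus_le_compat_r.
    apply Cmod_triangle.
  + eapply differentiable_on_subrectangle; eassumption.
- intros x y eps Hx Hy He. destruct (Hg x y Hx Hy) as [l Hl].
  set (p := x + y * Ci) in *.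
  destruct (Hl (eps / 2)%R ltac:(lra)) as [r [Hr P]].
  (* With both sides shorter than [r / 2], the sum of the coordinate distances to [p] stays below
     [r]. *)
  exists (r / 2)%R; split; [lra|].
  intros a' b' c' d' H1 H2 H3 H4 H5 H6.
  set (q := fun w => l * w + (g p - l * p)).
  assert (Dg : differentiable_on_rectangle g a' b' c' d')
    by (eapply differentiable_on_subrectangle; [exact Hg| | | |]; lra).
  assert (Dq : differentiable_on_rectangle q a' b' c' d')
    by (intros s t _ _; eexists; apply cderiv_linear).
  replace (rectangle_integral g a' b' c' d') with
    (rectangle_integral (fun w => g w - q w) a' b' c' d').
  2: { rewrite rectangle_integral_minus by (assumption || lra).
       unfold q. rewrite rectangle_integral_linear by lra. ring. }
  set (D := ((b' - a') + (d' - c'))%R).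
  replace (eps * D ^ 2)%R with (2 * D * (eps / 2 * D))%R by field.
  apply rectangle_integral_bound; try lra.
  { intros s t Hs Ht. destruct (Dg s t Hs Ht) as [k Hk]. eexists.
    apply cderiv_minus; [exact Hk|apply cderiv_linear]. }
  intros s t Hs Ht.
  pose proof (Cmod_rectangle s t x y) as B. fold p in B.
  assert (Rabs (s - x) <= b' - a')%R by (apply Rabs_le; lra).
  assert (Rabs (t - y) <= d' - c')%R by (apply Rabs_le; lra).
  unfold q.
  replace (g (s + t * Ci) - (l * (s + t * Ci) + (g p - l * p))) with
    (g (s + t * Ci) - g p - l * ((s + t * Ci) - p)) by ring.
  eapply Rle_trans; [apply P; lra|]. apply Rmult_le_compat_l; unfold D; lra.
Qed.
(** * The Cauchy estimate *)

Definition cexp (w : C) : C := ((exp (Re w) * cos (Im w))%R, (exp (Re w) * sin (Im w))%R).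

Lemma cexp_plus (z w : C) : cexp (z + w) = cexp z * cexp w.
Proof.
destruct z as [x y], w as [x' y'].
apply injective_projections; simpl; rewrite exp_plus, ?cos_plus, ?sin_plus; ring.
Qed.

Lemma cexp_0 : cexp 0 = 1.
Proof. apply injective_projections; simpl; rewrite exp_0, ?cos_0, ?sin_0; ring. Qed.

Lemma cexp_opp (w : C) : cexp w * cexp (- w) = 1.
Proof. rewrite <- cexp_plus, <- cexp_0. f_equal. ring. Qed.

Lemma Cmod_cexp (w : C) : Cmod (cexp w) = exp (Re w).
Proof.
destruct w as [x y]. unfold Cmod, cexp; simpl.
replace (exp x * cos y * (exp x * cos y * 1) + exp x * sin y * (exp x * sin y * 1))%R
 with (exp x * exp x * (Rsqr (sin y) + Rsqr (cos y)))%R by (unfold Rsqr; ring).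
rewrite sin2_cos2, Rmult_1_r. apply sqrt_square. left; apply exp_pos.
Qed.

Lemma cexp_periodic (w : C) : cexp (w + (2 * PI)%R * Ci) = cexp w.
Proof.
destruct w as [x y]. apply injective_projections; simpl.
- replace (x + (2 * PI * 0 - 0 * 1))%R with x by ring.
  replace (y + (2 * PI * 1 + 0 * 0))%R with (y + 2 * PI)%R by ring.
  rewrite <- (cos_period y 1); do 2 f_equal; simpl; ring.
- replace (x + (2 * PI * 0 - 0 * 1))%R with x by ring.
  replace (y + (2 * PI * 1 + 0 * 0))%R with (y + 2 * PI)%R by ring.
  rewrite <- (sin_period y 1); do 2 f_equal; simpl; ring.
Qed.

Lemma derivable_pt_lim_remainder (f : R -> R) (l eps : R) :
  derivable_pt_lim f 0 l -> (0 < eps)%R ->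
  exists d, (0 < d)%R /\
    forall h, (Rabs h < d)%R -> (Rabs (f h - f 0 - l * h) <= eps * Rabs h)%R.
Proof.
intros H He. destruct (H eps He) as [[d Hd] P]. exists d; split; [exact Hd|].
intros h Hh. destruct (Req_dec h 0) as [->|Hn].
{ replace (f 0 - f 0 - l * 0)%R with 0%R by ring. rewrite Rabs_R0. lra. }
specialize (P h Hn Hh). rewrite Rplus_0_l in P.
replace (f h - f 0 - l * h)%R with (((f h - f 0) / h - l) * h)%R by (field; exact Hn).
rewrite Rabs_mult. apply Rmult_le_compat_r; [apply Rabs_pos|lra].
Qed.

Lemma Cmod_le_Rabs (z : C) : (Cmod z <= Rabs (Re z) + Rabs (Im z))%R.
Proof.
destruct z as [x y].
pose proof (Cmod_rectangle x y 0 0) as H. rewrite !Rminus_0_r in H. simpl.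
replace (Cmod (x, y)) with (Cmod (x + y * Ci - (0%R + 0%R * Ci))); [exact H|].
f_equal. apply injective_projections; simpl; ring.
Qed.

Lemma Rabs_Im_le_Cmod (z : C) : (Rabs (Im z) <= Cmod z)%R.
Proof. eapply Rle_trans; [apply Rmax_r|apply Rmax_Cmod]. Qed.

Lemma cderiv_cexp_0 : cderiv cexp 0 1.
Proof.
intros eps He.
(* Four error terms will each be at most [eps / 6 * r]. The cosine and sine remainders get
   [eps / 18] because they are multiplied by [exp x <= 3]; in the mixed term [|exp x - 1| <= 2 r]
   meets [|y| < eps / 12]. *)
destruct (derivable_pt_lim_remainder exp 1 (eps / 6)) as [d1 [Hd1 P1]]; [|lra|].
{ pose proof (derivable_pt_lim_exp 0) as H; rewrite exp_0 in H; exact H. }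
destruct (derivable_pt_lim_remainder cos 0 (eps / 18)) as [d2 [Hd2 P2]]; [|lra|].
{ pose proof (derivable_pt_lim_cos 0) as H; rewrite sin_0, Ropp_0 in H; exact H. }
destruct (derivable_pt_lim_remainder sin 1 (eps / 18)) as [d3 [Hd3 P3]]; [|lra|].
{ pose proof (derivable_pt_lim_sin 0) as H; rewrite cos_0 in H; exact H. }
set (d4 := Rmin 1 (eps / 12)).
assert (Hd4 : (0 < d4)%R) by (apply Rmin_pos; lra).
destruct (derivable_pt_lim_remainder exp 1 1) as [d5 [Hd5 P5]]; [|lra|].
{ pose proof (derivable_pt_lim_exp 0) as H; rewrite exp_0 in H; exact H. }
set (d := Rmin d1 (Rmin d2 (Rmin d3 (Rmin d4 d5)))).
exists d. split; [repeat apply Rmin_pos; lra|].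
intros w. replace (w - 0) with w by ring. intros Hw.
assert (Hb : (Cmod w < d1 /\ Cmod w < d2 /\ Cmod w < d3 /\ Cmod w < d4 /\ Cmod w < d5)%R).
{ unfold d in Hw. apply Rlt_gt in Hw. do 4 (apply Rmin_Rgt_l in Hw; destruct Hw as [? Hw]). repeat split; assumption. }
destruct Hb as [B1 [B2 [B3 [B4 B5]]]].
pose proof (re_le_Cmod w) as Hx. pose proof (Rabs_Im_le_Cmod w) as Hy.
rewrite cexp_0. set (r := Cmod w) in *.
destruct w as [x y]; simpl in Hx, Hy.
specialize (P1 x ltac:(lra)). specialize (P2 y ltac:(lra)). specialize (P3 y ltac:(lra)).
specialize (P5 x ltac:(lra)).
rewrite exp_0 in *. rewrite cos_0 in *. rewrite sin_0 in *.
assert (Hr : (r < 1)%R) by (eapply Rlt_le_trans; [exact B4|apply Rmin_l]).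
assert (Hr' : (r < eps / 12)%R) by (eapply Rlt_le_trans; [exact B4|apply Rmin_r]).
pose proof (Rabs_pos x) as X0. pose proof (Rabs_pos y) as Y0.
assert (E1 : (Rabs (exp x - 1) <= 2 * r)%R).
{ replace (exp x - 1)%R with ((exp x - 1 - 1 * x) + x)%R by ring.
  eapply Rle_trans; [apply Rabs_triang|]. lra. }
assert (E3 : (Rabs (exp x) <= 3)%R).
{ replace (exp x) with ((exp x - 1) + 1)%R by ring.
  eapply Rle_trans; [apply Rabs_triang|]. rewrite Rabs_R1. lra. }
eapply Rle_trans; [apply Cmod_le_Rabs|]. simpl.
replace (exp x * cos y + - (1) + - (1 * x - 0 * y))%R with
  (exp x * (cos y - 1 - 0 * y) + (exp x - 1 - 1 * x))%R by ring.
replace (exp x * sin y + - 0 + - (1 * y + 0 * x))%R with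
  (exp x * (sin y - 0 - 1 * y) + (exp x - 1) * y)%R by ring.
assert (Q1 : (Rabs (exp x * (cos y - 1 - 0 * y)) <= 3 * (eps / 18 * r))%R).
{ rewrite Rabs_mult. apply Rmult_le_compat; try apply Rabs_pos; [exact E3|].
  eapply Rle_trans; [exact P2|]. apply Rmult_le_compat_l; lra. }
assert (Q2 : (Rabs (exp x * (sin y - 0 - 1 * y)) <= 3 * (eps / 18 * r))%R).
{ rewrite Rabs_mult. apply Rmult_le_compat; try apply Rabs_pos; [exact E3|].
  eapply Rle_trans; [exact P3|]. apply Rmult_le_compat_l; lra. }
assert (Q3 : (Rabs ((exp x - 1) * y) <= 2 * r * (eps / 12))%R).
{ rewrite Rabs_mult. apply Rmult_le_compat; try apply Rabs_pos; [exact E1|]. lra. }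
assert (Q4 : (eps / 6 * Rabs x <= eps / 6 * r)%R) by (apply Rmult_le_compat_l; lra).
assert (0 <= eps * r)%R by (apply Rmult_le_pos; [lra|apply Cmod_ge_0]).
eapply Rle_trans; [apply Rplus_le_compat; apply Rabs_triang|]. lra.
Qed.

Lemma cderiv_cexp (z : C) : cderiv cexp z (cexp z).
Proof.
intros eps He. pose proof (exp_pos (Re z)) as Hp.
destruct (cderiv_cexp_0 (eps / exp (Re z))%R) as [d [Hd P]]; [apply Rdiv_lt_0_compat; lra|].
exists d; split; [exact Hd|]. intros w Hw.
specialize (P (w - z)). replace (w - z - 0) with (w - z) in P by ring. specialize (P Hw).
replace (cexp w) with (cexp z * cexp (w - z)) by (rewrite <- cexp_plus; f_equal; ring).
rewrite cexp_0 in P.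
replace (cexp z * cexp (w - z) - cexp z - cexp z * (w - z)) with
  (cexp z * (cexp (w - z) - 1 - 1 * (w - z))) by ring.
rewrite Cmod_mult, Cmod_cexp.
apply (Rmult_le_compat_l (exp (Re z))) in P; [|lra].
replace (exp (Re z) * (eps / exp (Re z) * Cmod (w - z)))%R with (eps * Cmod (w - z))%R in P
  by (field; lra). exact P.
Qed.

Definition holomorphic_near (f : C -> C) (b : C) (r : R) : Prop :=
  forall w, (Cmod (w - b) < r)%R -> exists l, cderiv f w l.

(* In the logarithmic coordinate [w], with [z = b + exp w], the function
   [(f z - f b) / (z - b)] is [2 i pi]-periodic, so Goursat's theorem makes its
   integral over a period independent of [Re w]; as [Re w] tends to
   [-infinity] this integral tends to [2 i pi f'(b)]. *)
Lemma cauchy_estimate (f : C -> C) (b l : C) (r M : R) :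
  (0 < r)%R -> holomorphic_near f b r ->
  (forall w, (Cmod (w - b) < r)%R -> (Cmod (f w) <= M)%R) ->
  cderiv f b l -> (Cmod l <= 4 * M / r)%R.
Proof.
intros Hr Hf HM Hl.
set (F := fun w => (f (b + cexp w) - f b) * cexp (- w)).
(* The half-plane [Re w <= X] is mapped into the disk of radius [r / 2], well inside the domain of
   [f]. *)
set (X := ln (r / 2)).
assert (inX : forall w, (Re w <= X)%R -> (Cmod (b + cexp w - b) <= r / 2)%R).
{ intros w Hw. replace (b + cexp w - b) with (cexp w) by ring. rewrite Cmod_cexp.
  rewrite <- (exp_ln (r / 2)) by lra. destruct Hw as [Hw|Hw].
  left; now apply exp_increasing. rewrite Hw; right; reflexivity. }
assert (FD : forall w, (Re w <= X)%R -> exists k, cderiv F w k).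
{ intros w Hw. destruct (Hf (b + cexp w)) as [k Hk]; [pose proof (inX w Hw); lra|].
  eexists. unfold F. apply cderiv_mult.
  - apply cderiv_minus; [|apply cderiv_const].
    apply (cderiv_comp f (fun w => b + cexp w)); [exact Hk|].
    apply cderiv_plus; [apply cderiv_const|apply cderiv_cexp].
  - apply (cderiv_comp cexp Copp); [apply cderiv_cexp|apply cderiv_opp]. }
assert (FP : forall w, F (w + (2 * PI)%R * Ci) = F w).
{ intros w. unfold F. rewrite cexp_periodic.
  rewrite <- (cexp_periodic (- (w + (2 * PI)%R * Ci))).
  do 2 f_equal. ring. }
pose proof PI_RGT_0 as Hpi.
assert (vert : forall (x t : R), Re (x + t * Ci) = x) by (intros; simpl; ring).
assert (FV : forall x : R, (x <= X)%R -> forall t : R, (0 <= t <= 2 * PI)%R ->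
   exists k, cderiv F (x + t * Ci) k).
{ intros x Hx t _. apply FD. rewrite vert. exact Hx. }
assert (inv : forall x : R, (x <= X)%R ->
   seg F X Ci 0 (2 * PI) = seg F x Ci 0 (2 * PI)).
{ intros x Hx. pose proof (goursat F x X 0 (2 * PI) Hx ltac:(lra)) as G.
  unfold rectangle_integral in G.
  (* By periodicity the horizontal sides cancel, so Goursat's theorem equates the two vertical
     ones. *)
  assert (E : seg F ((2 * PI)%R * Ci) 1 x X = seg F (0%R * Ci) 1 x X).
  { unfold seg. apply (@RInt_ext C_R_CompleteNormedModule). intros t _.
    rewrite <- (FP (0%R * Ci + t * 1)). f_equal. f_equal. ring. }
  rewrite E in G.
  assert (H0 : differentiable_on_rectangle F x X 0 (2 * PI)) by (intros s t Hs Ht; apply FV; lra).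
  specialize (G H0).
  replace (seg F X Ci 0 (2 * PI)) with
   (seg F (0%R * Ci) 1 x X - seg F (0%R * Ci) 1 x X + seg F X Ci 0 (2 * PI)
     - seg F x Ci 0 (2 * PI) + seg F x Ci 0 (2 * PI)) by ring.
  rewrite G. ring. }
(* On this line [|f - f b| <= 2 M] and [|exp (- w)| = 2 / r]: this is where the factor 4 of the
   estimate comes from. *)
assert (S1 : (Cmod (seg F X Ci 0 (2 * PI)) <= 2 * PI * (2 * M / (r / 2)))%R).
{ replace (2 * PI * (2 * M / (r / 2)))%R with ((2 * PI - 0) * (Cmod Ci * (2 * M / (r / 2))))%R
    by (rewrite Cmod_Ci; field; lra).
  apply seg_bound; [lra|apply FV; lra|].
  intros t Ht. unfold F. rewrite Cmod_mult, Cmod_cexp.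
  replace (Re (- (X + t * Ci))) with (- X)%R by (simpl; ring).
  rewrite exp_Ropp. unfold X at 2. rewrite exp_ln by lra.
  apply Rmult_le_compat_r; [left; apply Rinv_0_lt_compat; lra|].
  eapply Rle_trans; [apply Cmod_triangle_minus|].
  assert (Cmod (f (b + cexp (X + t * Ci))%C) <= M)%R.
  { apply HM. pose proof (inX (X + t * Ci)) as Q. rewrite vert in Q. specialize (Q ltac:(lra)). lra. }
  assert (Cmod (f b) <= M)%R by (apply HM; rewrite Cmod_minus_0; lra). lra. }
assert (S2 : forall eps, (0 < eps)%R -> (2 * PI * Cmod l <= 2 * PI * (4 * M / r) + 2 * PI * eps)%R).
{ intros eps He. destruct (Hl eps He) as [d [Hd P]].
  (* Far enough to the left for [|exp w| < d], so that the integrand is within [eps] of the constant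
     [l]. *)
  set (x := Rmin X (ln (d / 2))).
  assert (Hx : (x <= X)%R) by apply Rmin_l.
  assert (Hc : seg (fun _ => l) x Ci 0 (2 * PI) = l * ((2 * PI)%R * Ci)).
  { rewrite (seg_primitive (fun w => l * w + 0)).
    - ring.
    - lra.
    - intros t _. apply cderiv_linear.
    - intros t _. exists 0. apply cderiv_const. }
  assert (Hs : (Cmod (seg F x Ci 0 (2 * PI) - l * ((2 * PI)%R * Ci)) <= 2 * PI * eps)%R).
  { rewrite <- Hc, <- seg_minus.
    - replace (2 * PI * eps)%R with ((2 * PI - 0) * (Cmod Ci * eps))%R by (rewrite Cmod_Ci; ring).
      apply seg_bound; [lra| |].
      + intros t Ht. destruct (FV x Hx t Ht) as [k Hk]. eexists.
        apply cderiv_minus; [exact Hk|apply cderiv_const].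
      + intros t _. set (w := (x + t * Ci)%C).
        assert (Hh : (Cmod (cexp w) < d)%R).
        { rewrite Cmod_cexp. unfold w; rewrite vert.
          apply Rle_lt_trans with (d / 2)%R; [|lra].
          rewrite <- (exp_ln (d / 2)) by lra.
          destruct (Rmin_r X (ln (d / 2))) as [Q|Q].
          - left; now apply exp_increasing.
          - unfold x; rewrite Q; right; reflexivity. }
        specialize (P (b + cexp w)). replace (b + cexp w - b) with (cexp w) in P by ring.
        specialize (P Hh). unfold F.
        replace ((f (b + cexp w) - f b) * cexp (- w) - l) with
          ((f (b + cexp w) - f b - l * cexp w) * cexp (- w)).
        2: { replace ((f (b + cexp w) - f b - l * cexp w) * cexp (- w)) with
               ((f (b + cexp w) - f b) * cexp (- w) - l * (cexp w * cexp (- w))) by ring.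
             rewrite cexp_opp; ring. }
        rewrite Cmod_mult.
        apply (Rmult_le_compat_r (Cmod (cexp (- w)))) in P; [|apply Cmod_ge_0].
        replace eps with (eps * Cmod (cexp w) * Cmod (cexp (- w)))%R; [exact P|].
        rewrite Rmult_assoc, <- Cmod_mult, cexp_opp, Cmod_1; ring.
    - lra.
    - apply FV, Hx.
    - intros t _. exists 0. apply cderiv_const. }
  rewrite <- (inv x Hx) in Hs.
  pose proof (Cmod_le_plus_minus (l * ((2 * PI)%R * Ci)) (seg F X Ci 0 (2 * PI))) as T.
  rewrite Cmod_minus_sym in T.
  rewrite !Cmod_mult, Cmod_Ci, Cmod_R, Rabs_pos_eq in T by lra.
  replace (2 * PI * (4 * M / r))%R with (2 * PI * (2 * M / (r / 2)))%R by (field; lra). lra. }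
destruct (Rle_lt_dec (Cmod l) (4 * M / r)) as [Q|Q]; [exact Q|exfalso].
specialize (S2 ((Cmod l - 4 * M / r) / 2)%R ltac:(lra)). nra.
Qed.

(** * Lipschitz bounds and limits with a rate *)

(** The mean value theorem has no equality for complex values, so it is applied to the real function
    [Re (conj D * f)] on the segment with [D = f y - f x]: its increment is [|D|^2], and one factor
    [|D|] is then cancelled. *)
Lemma mean_value_bound (f : C -> C) (x y : C) (K : R) :
  (forall t : R, (0 <= t <= 1)%R ->
     exists l, cderiv f (x + t * (y - x)) l /\ (Cmod l <= K)%R) ->
  (Cmod (f y - f x) <= K * Cmod (y - x))%R.
Proof.
intros H. set (D := f y - f x).
set (phi := fun t : R => Re (Cconj D * f (x + t * (y - x)))).
assert (Hd : forall (t : R) l, cderiv f (x + t * (y - x)) l ->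
   is_derive phi t (Re ((y - x) * (Cconj D * l)))).
{ intros t l Hl.
  pose proof (cderiv_along (fun w => Cconj D * f w) x (y - x) _ t (cderiv_scal f (Cconj D) _ _ Hl)) as Q.
  unfold is_derive in *. unfold phi.
  eapply filterdiff_ext_lin.
  - apply (filterdiff_comp' (U := R_NormedModule) (V := C_R_NormedModule) (W := R_NormedModule)
      (fun t : R => Cconj D * f (x + t * (y - x))) (fun z : C_R_NormedModule => fst z)).
    exact Q. apply filterdiff_linear, (is_linear_fst (U := R_NormedModule) (V := R_NormedModule)).
  - intros s. simpl. reflexivity. }
destruct (MVT_gen phi 0 1 (Derive phi)) as [c [Hc E]].
- intros t Ht. rewrite Rmin_left, Rmax_right in Ht by lra.
  destruct (H t ltac:(lra)) as [l [Hl _]]. apply Derive_correct. eexists; apply Hd, Hl.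
- intros t Ht. rewrite Rmin_left, Rmax_right in Ht by lra.
  destruct (H t ltac:(lra)) as [l [Hl _]].
  apply continuity_pt_filterlim, (ex_derive_continuous phi). eexists; apply Hd, Hl.
- rewrite Rmin_left, Rmax_right in Hc by lra.
  destruct (H c Hc) as [l [Hl HK]].
  rewrite (is_derive_unique _ _ _ (Hd c l Hl)) in E.
  assert (E2 : (Cmod D ^ 2 = phi 1 - phi 0)%R).
  { unfold phi. replace (x + 1%R * (y - x)) with y by ring.
    replace (x + 0%R * (y - x)) with x by ring.
    rewrite Cmod2_alt. unfold D. destruct (f y), (f x); simpl. ring. }
  pose proof (re_le_Cmod ((y - x) * (Cconj D * l))) as B.
  rewrite !Cmod_mult, Cmod_conj in B.
  pose proof (Rle_abs (Re ((y - x) * (Cconj D * l)))) as B'.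
  pose proof (Cmod_ge_0 D). pose proof (Cmod_ge_0 (y - x)) as H1.
  assert (Cmod (y - x) * Cmod l <= K * Cmod (y - x))%R by nra.
  destruct (Req_dec (Cmod D) 0) as [Z|Z].
  { rewrite Z. apply Rmult_le_pos; [|exact H1]. pose proof (Cmod_ge_0 l); lra. }
  apply (Rmult_le_reg_l (Cmod D)); [lra|].
  apply Rle_trans with (Cmod (y - x) * (Cmod D * Cmod l))%R; [|nra].
  replace (Cmod D * Cmod D)%R with (Cmod D ^ 2)%R by ring. lra.
Qed.

Lemma Cmod_segment (x y b : C) (t r : R) :
  (0 <= t <= 1)%R -> (Cmod (x - b) < r)%R -> (Cmod (y - b) < r)%R ->
  (Cmod (x + t * (y - x) - b) < r)%R.
Proof.
intros Ht Hx Hy.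
replace (x + t * (y - x) - b) with ((1 - t)%R * (x - b) + t * (y - b))
  by (rewrite RtoC_minus; ring).
eapply Rle_lt_trans; [apply Cmod_triangle|]. rewrite !Cmod_mult, !Cmod_R, !Rabs_pos_eq by lra.
destruct (Rle_lt_dec t (1 / 2)); nra.
Qed.

(** Each point of the half-size disk is the centre of a disk of radius [r / 2] inside the large one,
    so the Cauchy estimate bounds the derivative by [4 M / (r / 2)]. *)
Lemma holomorphic_lipschitz (f : C -> C) (b : C) (r M : R) :
  (0 < r)%R -> holomorphic_near f b r ->
  (forall w, (Cmod (w - b) < r)%R -> (Cmod (f w) <= M)%R) ->
  forall x y, (Cmod (x - b) < r / 2)%R -> (Cmod (y - b) < r / 2)%R ->
  (Cmod (f y - f x) <= 8 * M / r * Cmod (y - x))%R.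
Proof.
intros Hr Hf HM x y Hx Hy. apply mean_value_bound. intros t Ht.
pose proof (Cmod_segment x y b t (r / 2) Ht Hx Hy) as Hw.
set (w := x + t * (y - x)) in *.
assert (In : forall v, (Cmod (v - w) < r / 2)%R -> (Cmod (v - b) < r)%R).
{ intros v Hv. pose proof (Cmod_chain v w b). lra. }
destruct (Hf w ltac:(lra)) as [l Hl]. exists l; split; [exact Hl|].
replace (8 * M / r)%R with (4 * M / (r / 2))%R by (field; lra).
apply (cauchy_estimate f w l (r / 2) M); auto; [lra|].
intros v Hv. apply Hf, In, Hv.
Qed.

Lemma Cauchy_net_limit (s : C -> C) (K rho : R) :
  (0 < rho)%R -> (0 <= K)%R ->
  (forall h k : C, h <> 0 -> k <> 0 -> (Cmod h < rho)%R -> (Cmod k < rho)%R ->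
     (Cmod (s h - s k) <= K * (Cmod h + Cmod k))%R) ->
  exists m, forall h : C, h <> 0 -> (Cmod h < rho)%R -> (Cmod (s h - m) <= K * Cmod h)%R.
Proof.
intros Hr HK Hs.
(* A test sequence tending to zero; the shift by 2 keeps every term, including the one for [n = 0],
   strictly below [rho]. *)
set (h := fun n : nat => RtoC (rho / (INR n + 2))).
assert (Hp : forall n, (0 < INR n + 2)%R) by (intros n; pose proof (pos_INR n); lra).
assert (Hm : forall n, Cmod (h n) = (rho / (INR n + 2))%R).
{ intros n. unfold h. rewrite Cmod_R, Rabs_pos_eq; [reflexivity|].
  left; apply Rdiv_lt_0_compat; auto. }
assert (Hn : forall n, h n <> 0 /\ (Cmod (h n) < rho)%R).
{ intros n. split.
  - apply Cmod_gt_0. rewrite Hm. apply Rdiv_lt_0_compat; auto.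
  - rewrite Hm. apply Rlt_div_l; [apply Hp|]. pose proof (pos_INR n). nra. }
assert (Hsmall : forall e, (0 < e)%R -> eventually (fun n => (Cmod (h n) < e)%R)).
{ intros e He. destruct (nfloor_ex (rho / e)) as [N HN].
  { left; apply Rdiv_lt_0_compat; lra. }
  exists N. intros n Hle. rewrite Hm. apply Rlt_div_l; [apply Hp|].
  apply le_INR in Hle. destruct HN as [_ HN]. apply Rlt_div_l in HN; [|lra]. nra. }
destruct (proj1 (filterlim_locally_cauchy (U := C_R_CompleteNormedModule) (F := eventually)
   (fun n => s (h n)))) as [m Hlim].
{ intros [e He].
  exists (fun n => (Cmod (h n) < e / (2 * (K + 1)))%R). split.
  { apply Hsmall. apply Rdiv_lt_0_compat; lra. }
  intros u v Hu Hv. apply C_NormedModule_mixin_compat1. simpl.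
  change (Cmod (s (h v) - s (h u)) < e)%R.
  eapply Rle_lt_trans; [exact (Hs _ _ (proj1 (Hn v)) (proj1 (Hn u)) (proj2 (Hn v)) (proj2 (Hn u)))|].
  apply Rlt_div_r in Hu; [|lra]. apply Rlt_div_r in Hv; [|lra].
  pose proof (Cmod_ge_0 (h u)). pose proof (Cmod_ge_0 (h v)). nra. }
exists m. intros k Hk Hkr.
destruct (Rle_lt_dec (Cmod (s k - m)) (K * Cmod k)) as [Q|Q]; [exact Q|exfalso].
set (e := (Cmod (s k - m) - K * Cmod k)%R) in *.
assert (He : (0 < e)%R) by (unfold e; lra).
(* A ball of the product uniform structure of radius [e / 4] only gives a modulus below
   [sqrt 2 * (e / 4) < e / 2]; the other half of [e] absorbs [K * Cmod (h n)]. *)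
assert (He' : (0 < e / 4)%R) by lra.
pose proof (proj1 (filterlim_locally (U := C_R_CompleteNormedModule) _ _) Hlim (mkposreal _ He')) as L.
assert (L2 := Hsmall (e / (2 * (K + 1)))%R ltac:(apply Rdiv_lt_0_compat; lra)).
destruct L as [n1 L]. destruct L2 as [n2 L2].
specialize (L (max n1 n2) ltac:(lia)). specialize (L2 (max n1 n2) ltac:(lia)).
set (n := max n1 n2) in *.
apply C_NormedModule_mixin_compat2 in L. simpl in L.
change (Cmod (s (h n) - m) < sqrt 2 * (e / 4))%R in L.
assert (sqrt 2 < 2)%R.
{ rewrite <- (sqrt_square 2) at 2 by lra. apply sqrt_lt_1; lra. }
pose proof (Hs k (h n) Hk (proj1 (Hn n)) Hkr (proj2 (Hn n))) as B.
pose proof (Cmod_chain (s k) (s (h n)) m).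
apply Rlt_div_r in L2; [|lra]. pose proof (Cmod_ge_0 (h n)).
unfold e in *. nra.
Qed.

(** * The second derivative and division by a zero *)

Definition cderivative (f : C -> C) (z : C) : C :=
  epsilon (inhabits (RtoC 0)) (fun l => cderiv f z l).

Lemma cderivative_correct (f : C -> C) (b : C) (r : R) :
  holomorphic_near f b r ->
  forall w, (Cmod (w - b) < r)%R -> cderiv f w (cderivative f w).
Proof.
intros Hf w Hw.
apply (epsilon_spec (inhabits (RtoC 0)) (fun l => cderiv f w l)), Hf, Hw.
Qed.

Lemma cderiv_shift (f : C -> C) (h w l : C) :
  cderiv f (w + h) l -> cderiv (fun v => f (v + h)) w l.
Proof.
intros H. replace l with (l * 1) by ring.
apply (cderiv_comp f (fun v => v + h)); [exact H|].
replace (RtoC 1) with (1 + 0) by ring. apply cderiv_plus; [apply cderiv_id|apply cderiv_const].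
Qed.

(** The number [f' y - f' x] is the derivative at [x] of [w => f (w + h) - f w] with [h = y - x].
    That function is bounded by [8 M / r * |h|], and the Cauchy estimate on radius [r / 4] yields
    [128 M / r^2]. *)
Lemma derivative_lipschitz (f : C -> C) (b : C) (r M : R) :
  (0 < r)%R -> holomorphic_near f b r ->
  (forall w, (Cmod (w - b) < r)%R -> (Cmod (f w) <= M)%R) ->
  forall x y, (Cmod (x - b) < r / 4)%R -> (Cmod (y - b) < r / 4)%R ->
  (Cmod (cderivative f y - cderivative f x) <= 128 * M / r ^ 2 * Cmod (y - x))%R.
Proof.
intros Hr Hf HM x y Hx Hy.
set (h := y - x).
replace (128 * M / r ^ 2 * Cmod h)%R with (4 * (8 * M / r * Cmod h) / (r / 4))%R by (field; lra).
assert (In : forall w, (Cmod (w - x) < r / 4)%R ->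
   (Cmod (w - b) < r / 2)%R /\ (Cmod (w + h - b) < r / 2)%R).
{ intros w Hw. split.
  - pose proof (Cmod_chain w x b). lra.
  - replace (w + h - b) with ((w - x) + (y - b)) by (unfold h; ring).
    eapply Rle_lt_trans; [apply Cmod_triangle|]. lra. }
apply (cauchy_estimate (fun w => f (w + h) - f w) x); [lra| | |].
- intros w Hw. destruct (In w Hw) as [I1 I2]. eexists. apply cderiv_minus.
  + apply cderiv_shift, (cderivative_correct f b r Hf). lra.
  + apply (cderivative_correct f b r Hf). lra.
- intros w Hw. destruct (In w Hw) as [I1 I2].
  pose proof (holomorphic_lipschitz f b r M Hr Hf HM w (w + h) I1 I2) as Q.
  replace (w + h - w) with h in Q by ring. exact Q.
- apply cderiv_minus.
  + apply cderiv_shift. replace (x + h) with y by (unfold h; ring).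
    apply (cderivative_correct f b r Hf). lra.
  + apply (cderivative_correct f b r Hf). lra.
Qed.

(** The mean value bound is applied to [f] minus its tangent at [x], whose derivative on the segment
    is at most [K |y - x|]. *)
Lemma first_order_remainder (f : C -> C) (b : C) (r M : R) :
  (0 < r)%R -> holomorphic_near f b r ->
  (forall w, (Cmod (w - b) < r)%R -> (Cmod (f w) <= M)%R) ->
  forall x y, (Cmod (x - b) < r / 4)%R -> (Cmod (y - b) < r / 4)%R ->
  (Cmod (f y - f x - cderivative f x * (y - x)) <= 128 * M / r ^ 2 * Cmod (y - x) ^ 2)%R.
Proof.
intros Hr Hf HM x y Hx Hy.
assert (HM0 : (0 <= M)%R).
{ apply Rle_trans with (1 := Cmod_ge_0 (f b)). apply HM. rewrite Cmod_minus_0; lra. }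
set (K := (128 * M / r ^ 2)%R).
assert (HK : (0 <= K)%R).
{ unfold K. apply Rmult_le_pos; [lra|]. left; apply Rinv_0_lt_compat, pow_lt, Hr. }
replace (f y - f x - cderivative f x * (y - x)) with
  ((f y - (cderivative f x * y + 0)) - (f x - (cderivative f x * x + 0))) by ring.
replace (K * Cmod (y - x) ^ 2)%R with (K * Cmod (y - x) * Cmod (y - x))%R by ring.
apply (mean_value_bound (fun w => f w - (cderivative f x * w + 0))). intros t Ht.
pose proof (Cmod_segment x y b t (r / 4) Ht Hx Hy) as Hw. set (w := x + t * (y - x)) in *.
eexists; split.
- apply cderiv_minus; [apply (cderivative_correct f b r Hf); lra|apply cderiv_linear].
- eapply Rle_trans; [apply (derivative_lipschitz f b r M); assumption|]. fold K.
  apply Rmult_le_compat_l; [exact HK|].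
  unfold w. replace (x + t * (y - x) - x) with (t * (y - x)) by ring.
  rewrite Cmod_mult, Cmod_R, Rabs_pos_eq by lra. pose proof (Cmod_ge_0 (y - x)). nra.
Qed.

(* The difference quotients [(f (w + h) - f w) / h] are uniformly Cauchy as
   [h -> 0], hence by the Cauchy estimate so are those of the derivative. *)
Lemma derivative_differentiable (f : C -> C) (b : C) (r M : R) :
  (0 < r)%R -> holomorphic_near f b r ->
  (forall w, (Cmod (w - b) < r)%R -> (Cmod (f w) <= M)%R) ->
  exists m, cderiv (cderivative f) b m.
Proof.
intros Hr Hf HM.
assert (HM0 : (0 <= M)%R).
{ apply Rle_trans with (1 := Cmod_ge_0 (f b)). apply HM. rewrite Cmod_minus_0; lra. }
set (K := (128 * M / r ^ 2)%R).
assert (HK : (0 <= K)%R).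
{ unfold K. apply Rmult_le_pos; [lra|]. left; apply Rinv_0_lt_compat, pow_lt, Hr. }
(* The Cauchy estimate on radius [r / 8] turns [K] into [4 K / (r / 8)]; that radius keeps both [w]
   and [w + h] within [r / 4] of [b], where the remainder bound holds. *)
set (L := (32 * K / r)%R).
assert (HL : (0 <= L)%R).
{ unfold L. apply Rmult_le_pos; [lra|]. left; apply Rinv_0_lt_compat, Hr. }
assert (D : forall h w, (Cmod h < r / 8)%R -> (Cmod (w - b) < r / 8)%R ->
  cderiv (fun w => / h * (f (w + h) - f w)) w (/ h * (cderivative f (w + h) - cderivative f w))).
{ intros h w Hh Hw. apply cderiv_scal, cderiv_minus.
  - apply cderiv_shift, (cderivative_correct f b r Hf).
    replace (w + h - b) with ((w - b) + h) by ring.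
    eapply Rle_lt_trans; [apply Cmod_triangle|]. lra.
  - apply (cderivative_correct f b r Hf). lra. }
assert (B : forall h w : C, h <> 0 -> (Cmod h < r / 8)%R -> (Cmod (w - b) < r / 8)%R ->
  (Cmod (/ h * (f (w + h) - f w) - cderivative f w)%C <= K * Cmod h)%R).
{ intros h w H0 Hh Hw.
  pose proof (first_order_remainder f b r M Hr Hf HM w (w + h)) as Q. fold K in Q.
  replace (w + h - w) with h in Q by ring.
  replace (/ h * (f (w + h) - f w) - cderivative f w) with
   ((f (w + h) - f w - cderivative f w * h) / h) by (field; exact H0).
  rewrite Cmod_div by exact H0. apply Cmod_gt_0 in H0. apply Rle_div_l; [exact H0|].
  replace (K * Cmod h * Cmod h)%R with (K * Cmod h ^ 2)%R by ring. apply Q; [lra|].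
  replace (w + h - b) with ((w - b) + h) by ring.
  eapply Rle_lt_trans; [apply Cmod_triangle|]. lra. }
destruct (Cauchy_net_limit (fun h => / h * (cderivative f (b + h) - cderivative f b)) L (r / 8))
  as [m Hm]; [lra|exact HL| |].
{ intros h k Hh Hk Hh8 Hk8.
  replace (L * (Cmod h + Cmod k))%R with (4 * (K * (Cmod h + Cmod k)) / (r / 8))%R
    by (unfold L; field; lra).
  apply (cauchy_estimate (fun w => / h * (f (w + h) - f w) - / k * (f (w + k) - f w)) b); [lra| | |].
  - intros w Hw. eexists. apply cderiv_minus; apply D; assumption.
  - intros w Hw. pose proof (B h w Hh Hh8 Hw) as B1. pose proof (B k w Hk Hk8 Hw) as B2.
    eapply Rle_trans; [apply (Cmod_chain _ (cderivative f w))|].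
    rewrite (Cmod_minus_sym (cderivative f w)). lra.
  - apply cderiv_minus; apply D; try assumption; rewrite Cmod_minus_0; lra. }
exists m. intros eps He.
exists (Rmin (r / 8) (eps / (L + 1))). split.
{ apply Rmin_pos; [lra|]. apply Rdiv_lt_0_compat; lra. }
intros w Hw. set (h := w - b) in *.
pose proof (Rlt_le_trans _ _ _ Hw (Rmin_l _ _)) as Hw1.
pose proof (Rlt_le_trans _ _ _ Hw (Rmin_r _ _)) as Hw2.
apply Rlt_div_r in Hw2; [|lra].
destruct (Ceq_dec h 0) as [Z|Z].
{ replace w with b by (replace w with (h + b) by (unfold h; ring); rewrite Z; ring).
  rewrite Z. replace (cderivative f b - cderivative f b - m * 0) with (RtoC 0) by ring.
  rewrite Cmod_0. lra. }
specialize (Hm h Z Hw1). replace (b + h) with w in Hm by (unfold h; ring).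
replace (cderivative f w - cderivative f b - m * h) with
  (h * (/ h * (cderivative f w - cderivative f b) - m)) by (field; exact Z).
rewrite Cmod_mult, Rmult_comm. apply Rmult_le_compat_r; [apply Cmod_ge_0|].
pose proof (Cmod_ge_0 h). nra.
Qed.

(** The quotient is extended by [f' p]; its differentiability at [p] comes from the second
    derivative of [f]. The bound holds on the full disk, with no loss of radius: Lipschitz estimate
    for [|w - p| < r / 2], the trivial bound beyond, the Cauchy estimate at [p]. This is what lets
    the division be iterated. *)
Lemma divide_zero (f : C -> C) (p : C) (r M : R) :
  (0 < r)%R -> holomorphic_near f p r ->
  (forall w, (Cmod (w - p) < r)%R -> (Cmod (f w) <= M)%R) ->
  f p = 0 ->
  exists g, holomorphic_near g p r /\
    (forall w, (Cmod (w - p) < r)%R -> (Cmod (g w) <= 8 * M / r)%R) /\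
    (forall w, f w = (w - p) * g w).
Proof.
intros Hr Hf HM Hp.
assert (HM0 : (0 <= M)%R).
{ apply Rle_trans with (1 := Cmod_ge_0 (f p)). apply HM. rewrite Cmod_minus_0; lra. }
assert (Dp : cderiv f p (cderivative f p))
  by (apply (cderivative_correct f p r Hf); rewrite Cmod_minus_0; exact Hr).
set (g := fun w => if Ceq_dec w p then cderivative f p else f w / (w - p)).
assert (NZ : forall w, w <> p -> w - p <> 0).
{ intros w N E. apply N. replace w with (w - p + p) by ring. rewrite E; ring. }
assert (Hg : forall w, w <> p -> g w = f w / (w - p)).
{ intros w N. unfold g. destruct (Ceq_dec w p); [contradiction|reflexivity]. }
assert (Hgp : g p = cderivative f p).
{ unfold g. destruct (Ceq_dec p p); [reflexivity|contradiction]. }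
exists g. split; [|split].
- intros w Hw. destruct (Ceq_dec w p) as [->|N].
  + destruct (derivative_differentiable f p r M Hr Hf HM) as [m Hm].
    (* Second-order Taylor expansion: [f] minus its quadratic part has derivative
       [f' v - f' p - m (v - p)], at most [eps |v - p|], so the remainder is at most
       [eps |w - p|^2], and one factor is lost in dividing. *)
    exists (m / 2). intros eps He. destruct (Hm eps He) as [d [Hd P]].
    exists (Rmin d r). split; [now apply Rmin_pos|]. intros w Hwd.
    destruct (Ceq_dec w p) as [->|Nw].
    { replace (g p - g p - m / 2 * (p - p)) with (RtoC 0) by ring.
      rewrite Cmod_0. apply Rmult_le_pos; [lra|apply Cmod_ge_0]. }
    assert (T : (Cmod ((f w - (cderivative f p * (w - p) + m / 2 * ((w - p) * (w - p)))) -
       (f p - (cderivative f p * (p - p) + m / 2 * ((p - p) * (p - p)))))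
       <= eps * Cmod (w - p) * Cmod (w - p))%R).
    { apply (mean_value_bound (fun v => f v - (cderivative f p * (v - p) + m / 2 * ((v - p) * (v - p))))).
      intros t Ht. set (v := p + t * (w - p)).
      assert (Hv : (Cmod (v - p) <= Cmod (w - p))%R).
      { unfold v. replace (p + t * (w - p) - p) with (t * (w - p)) by ring.
        rewrite Cmod_mult, Cmod_R, Rabs_pos_eq by lra. pose proof (Cmod_ge_0 (w - p)). nra. }
      pose proof (Rlt_le_trans _ _ _ Hwd (Rmin_l _ _)).
      pose proof (Rlt_le_trans _ _ _ Hwd (Rmin_r _ _)).
      exists (cderivative f v - (cderivative f p * 1 + m / 2 * (2 * (v - p) * 1))). split.
      - assert (S : cderiv (fun v => v - p) v 1).
        { replace (RtoC 1) with (1 - 0) by ring. apply cderiv_minus; [apply cderiv_id|apply cderiv_const]. }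
        apply cderiv_minus; [apply (cderivative_correct f p r Hf); lra|].
        apply cderiv_plus; apply cderiv_scal; [exact S|].
        apply (cderiv_comp (fun v => v * v) (fun v => v - p)); [apply cderiv_square|exact S].
      - replace (cderivative f v - (cderivative f p * 1 + m / 2 * (2 * (v - p) * 1))) with
          (cderivative f v - cderivative f p - m * (v - p)) by field.
        eapply Rle_trans; [apply P; lra|]. apply Rmult_le_compat_l; lra. }
    rewrite Hp in T. rewrite Hg, Hgp by exact Nw.
    replace (f w / (w - p) - cderivative f p - m / 2 * (w - p)) with
     ((f w - (cderivative f p * (w - p) + m / 2 * ((w - p) * (w - p))) -
       (0 - (cderivative f p * (p - p) + m / 2 * ((p - p) * (p - p))))) / (w - p))
       by (field; auto).
    rewrite Cmod_div by auto. apply Rle_div_l; [apply Cmod_gt_0; auto|exact T].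
  + destruct (Hf w Hw) as [l Hl].
    exists (l * / (w - p) + f w * (- / ((w - p) * (w - p)) * (1 - 0))).
    apply (cderiv_ext_loc (fun v => f v * / (v - p)) g w _ (Cmod (w - p))).
    * apply Cmod_gt_0; auto.
    * intros v Hv. rewrite Hg; [reflexivity|]. intros ->. rewrite Cmod_minus_sym in Hv. lra.
    * apply (cderiv_mult f (fun v => / (v - p))); [exact Hl|].
      apply (cderiv_comp Cinv (fun v => v - p) w (- / ((w - p) * (w - p))) (1 - 0));
        [apply (cderiv_inv (w - p)); auto|].
      apply cderiv_minus; [apply cderiv_id|apply cderiv_const].
- assert (Hi : (0 <= M / r)%R).
  { apply Rmult_le_pos; [lra|]. left; apply Rinv_0_lt_compat, Hr. }
  intros w Hw. destruct (Ceq_dec w p) as [->|N].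
  + rewrite Hgp. pose proof (cauchy_estimate f p _ r M Hr Hf HM Dp).
    unfold Rdiv in *. lra.
  + rewrite Hg, Cmod_div by auto. pose proof (proj1 (Cmod_gt_0 _) (NZ w N)) as Hwp.
    apply Rle_div_l; [exact Hwp|].
    destruct (Rlt_le_dec (Cmod (w - p)) (r / 2)) as [Q|Q].
    * pose proof (holomorphic_lipschitz f p r M Hr Hf HM p w) as B.
      rewrite Hp in B. replace (f w - 0) with (f w) in B by ring.
      apply B; [rewrite Cmod_minus_0; lra|exact Q].
    * eapply Rle_trans; [apply HM, Hw|].
      apply Rle_trans with (8 * M / r * (r / 2))%R.
      { replace (8 * M / r * (r / 2))%R with (4 * M)%R by (field; lra). lra. }
      apply Rmult_le_compat_l; [unfold Rdiv in *; lra|exact Q].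
- intros w. destruct (Ceq_dec w p) as [->|N].
  + rewrite Hp. ring.
  + rewrite Hg by exact N. field. auto.
Qed.
(** * The identity theorem *)

Definition nonisolated_zero (f : C -> C) (p : C) : Prop :=
  forall eps : R, (0 < eps)%R -> exists z, z <> p /\ (Cmod (z - p) < eps)%R /\ f z = 0.

(** Away from [p] the quotient has the same zeros as [f], so they still accumulate at [p] and the
    induction continues with the quotient; [f] and [M] are quantified after [n] because both change
    at each division. *)
Lemma nonisolated_zero_bound (p : C) (r : R) (n : nat) :
  (0 < r)%R -> forall (f : C -> C) (M : R), holomorphic_near f p r ->
  (forall w, (Cmod (w - p) < r)%R -> (Cmod (f w) <= M)%R) ->
  nonisolated_zero f p ->
  forall z, (Cmod (z - p) < r)%R -> (Cmod (f z) <= M * (8 / r * Cmod (z - p)) ^ n)%R.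
Proof.
intros Hr. induction n as [|n IH]; intros f M Hf HM Hz z Hzr.
{ simpl. rewrite Rmult_1_r. now apply HM. }
assert (near : forall h, holomorphic_near h p r ->
  (forall e : R, (0 < e)%R -> exists d, (0 < d)%R /\
    forall w, (Cmod (w - p) < d)%R -> (Cmod (h w - h p) < e)%R)).
{ intros h Hh. destruct (Hh p) as [l Hl]; [rewrite Cmod_minus_0; exact Hr|].
  exact (cderiv_continuous h p l Hl). }
assert (Hp : f p = 0).
{ apply Cmod_eq_0. destruct (Rle_lt_dec (Cmod (f p)) 0) as [Q|Q].
  { apply Rle_antisym; [exact Q|apply Cmod_ge_0]. }
  destruct (near f Hf _ Q) as [d [Hd P]]. destruct (Hz d Hd) as [w [_ [Hw E]]].
  specialize (P w Hw). rewrite E, Cmod_minus_sym in P.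
  replace (f p - 0) with (f p) in P by ring. lra. }
destruct (divide_zero f p r M Hr Hf HM Hp) as [g [Hg [HgM E]]].
assert (Hgz : nonisolated_zero g p).
{ intros e He. destruct (Hz e He) as [w [Hne [Hw Hfw]]]. exists w. repeat split; auto.
  rewrite E in Hfw. destruct (Ceq_dec (g w) 0) as [Q|Q]; [exact Q|exfalso].
  assert (w - p <> 0).
  { intros K. apply Hne. replace w with (w - p + p) by ring. rewrite K; ring. }
  now apply (Cmult_neq_0 (w - p) (g w)). }
rewrite E, Cmod_mult.
eapply Rle_trans.
{ apply Rmult_le_compat_l; [apply Cmod_ge_0|]. apply (IH g (8 * M / r)%R Hg HgM Hgz z Hzr). }
right. simpl. field. lra.
Qed.

(** On the disk of radius [r / 8] the ratio [8 / r * |z - p|] is below 1, so its powers tend to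
    zero. *)
Lemma local_identity (f : C -> C) (p : C) (r M : R) :
  (0 < r)%R -> holomorphic_near f p r ->
  (forall w, (Cmod (w - p) < r)%R -> (Cmod (f w) <= M)%R) ->
  nonisolated_zero f p -> forall z, (Cmod (z - p) < r / 8)%R -> f z = 0.
Proof.
intros Hr Hf HM Hz z Hzr.
assert (HM0 : (0 <= M)%R).
{ apply Rle_trans with (1 := Cmod_ge_0 (f p)). apply HM. rewrite Cmod_minus_0; lra. }
apply Cmod_eq_0. destruct (Rle_lt_dec (Cmod (f z)) 0) as [Q|Q].
{ apply Rle_antisym; [exact Q|apply Cmod_ge_0]. }
exfalso. set (q := (8 / r * Cmod (z - p))%R).
assert (Hq : (0 <= q < 1)%R).
{ unfold q. split.
  - apply Rmult_le_pos; [|apply Cmod_ge_0]. left; apply Rdiv_lt_0_compat; lra.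
  - replace 1%R with (8 / r * (r / 8))%R by (field; lra).
    apply Rmult_lt_compat_l; [apply Rdiv_lt_0_compat; lra|exact Hzr]. }
destruct (pow_lt_1_zero q ltac:(rewrite Rabs_pos_eq; lra) (Cmod (f z) / (M + 1))) as [n Hn].
{ apply Rdiv_lt_0_compat; lra. }
specialize (Hn n (le_n n)). rewrite Rabs_pos_eq in Hn by (apply pow_le; lra).
pose proof (nonisolated_zero_bound p r n Hr f M Hf HM Hz z ltac:(lra)) as B. fold q in B.
apply Rlt_div_r in Hn; [|lra]. pose proof (pow_le q n (proj1 Hq)). nra.
Qed.

(** By convexity every disk of radius [r] centred on the segment from [p] to [q] lies in the unit
    disk. One step length below [r / 8] therefore works all along, and the vanishing is carried from
    [p] to [q] in finitely many steps. *)
Lemma identity_disk (f : C -> C) (p : C) (M : R) :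
  (forall z, disk z -> exists l, cderiv f z l) ->
  (forall z, disk z -> (Cmod (f z) <= M)%R) ->
  disk p -> nonisolated_zero f p -> forall q, disk q -> f q = 0.
Proof.
unfold disk. intros Hf HM Hp Hz q Hq.
set (r := Rmin (1 - Cmod p) (1 - Cmod q)).
assert (Hr : (0 < r)%R) by (apply Rmin_pos; lra).
assert (Hrp : (r <= 1 - Cmod p)%R) by apply Rmin_l.
assert (Hrq : (r <= 1 - Cmod q)%R) by apply Rmin_r.
assert (In : forall t : R, (0 <= t <= 1)%R -> forall w,
   (Cmod (w - (p + t * (q - p))) < r)%R -> (Cmod w < 1)%R).
{ intros t Ht w Hw.
  assert (B : (Cmod (p + t * (q - p)) <= 1 - r)%R).
  { replace (p + t * (q - p)) with ((1 - t)%R * p + t * q) by (rewrite RtoC_minus; ring).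
    eapply Rle_trans; [apply Cmod_triangle|]. rewrite !Cmod_mult, !Cmod_R, !Rabs_pos_eq by lra.
    nra. }
  pose proof (Cmod_le_plus_minus w (p + t * (q - p))). lra. }
assert (Loc : forall t : R, (0 <= t <= 1)%R -> nonisolated_zero f (p + t * (q - p)) ->
   forall z, (Cmod (z - (p + t * (q - p))) < r / 8)%R -> f z = 0).
{ intros t Ht. apply (local_identity f _ r M Hr).
  - intros w Hw. apply Hf, (In t Ht w Hw).
  - intros w Hw. apply HM, (In t Ht w Hw). }
destruct (nfloor_ex (8 * Cmod (q - p) / r)) as [N HN].
{ apply Rmult_le_pos; [pose proof (Cmod_ge_0 (q - p)); lra|]. left; apply Rinv_0_lt_compat, Hr. }
destruct HN as [_ HN]. set (n := (INR N + 1)%R) in *.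
assert (Hn : (1 <= n)%R) by (unfold n; pose proof (pos_INR N); lra).
assert (Hstep : (Cmod (q - p) / n < r / 8)%R).
{ apply Rlt_div_l; [lra|]. apply Rlt_div_l in HN; [|exact Hr]. lra. }
assert (Ind : forall k : nat, (INR k <= n)%R ->
   forall z, (Cmod (z - (p + (INR k / n)%R * (q - p))) < r / 8)%R -> f z = 0).
{ induction k as [|k IH]; intros Hk.
  - apply Loc; simpl; replace (0 / n)%R with 0%R by (field; lra).
    + lra.
    + replace (p + 0%R * (q - p)) with p by ring. exact Hz.
  - rewrite S_INR in *. specialize (IH ltac:(lra)).
    pose proof (pos_INR k) as Hk0.
    apply Loc.
    { split; [apply Rmult_le_pos; [lra|left; apply Rinv_0_lt_compat; lra]|].
      apply Rle_div_l; lra. }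
    set (c := p + ((INR k + 1) / n)%R * (q - p)).
    assert (Hc : (Cmod (c - (p + (INR k / n)%R * (q - p))) < r / 8)%R).
    { replace (c - (p + (INR k / n)%R * (q - p))) with (RtoC (/ n) * (q - p)).
      - rewrite Cmod_mult, Cmod_R, Rabs_pos_eq.
        + rewrite Rmult_comm. exact Hstep.
        + left; apply Rinv_0_lt_compat; lra.
      - unfold c. replace ((INR k + 1) / n)%R with (INR k / n + / n)%R by (field; lra).
        rewrite RtoC_plus. ring. }
    intros e He.
    (* The new centre [c] lies inside the previous disk of zeros, and [c + d / 2] is another point
       of it within [e] of [c]. *)
    set (d := Rmin e (r / 8 - Cmod (c - (p + (INR k / n)%R * (q - p))))).
    assert (Hd : (0 < d)%R) by (apply Rmin_pos; lra).
    pose proof (Rmin_l e (r / 8 - Cmod (c - (p + (INR k / n)%R * (q - p))))) as D1. fold d in D1.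
    pose proof (Rmin_r e (r / 8 - Cmod (c - (p + (INR k / n)%R * (q - p))))) as D2. fold d in D2.
    assert (Hm : (Cmod (c + (d / 2)%R - c) = d / 2)%R).
    { replace (c + (d / 2)%R - c) with (RtoC (d / 2)) by ring. rewrite Cmod_R, Rabs_pos_eq; lra. }
    exists (c + (d / 2)%R). split; [|split].
    + intros E. rewrite E, Cmod_minus_0 in Hm. lra.
    + rewrite Hm. lra.
    + apply IH. pose proof (Cmod_chain (c + (d / 2)%R) c (p + (INR k / n)%R * (q - p))). lra. }
assert (En : n = INR (S N)) by (rewrite S_INR; reflexivity).
apply (Ind (S N)); rewrite <- En; [lra|].
replace (n / n)%R with 1%R by (field; lra).
replace (q - (p + 1%R * (q - p))) with (RtoC 0) by ring. rewrite Cmod_0. lra.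
Qed.
(** * Self-maps of the disk close to the identity in Stolz angles *)

Definition cderiv_self_map (f : C -> C) : Prop :=
  (forall z, disk z -> exists l, cderiv f z l) /\ forall z, disk z -> disk (f z).

Lemma holomorphic_cderiv_self_map (f : C -> C) : holomorphic_self_map f -> cderiv_self_map f.
Proof.
intros [H1 H2]. split; [|exact H2]. intros z Hz. apply ex_derive_cderiv, H1, Hz.
Qed.

Lemma cderiv_self_map_comp (f g : C -> C) :
  cderiv_self_map f -> cderiv_self_map g -> cderiv_self_map (fun z => f (g z)).
Proof.
intros [F1 F2] [G1 G2]. split; [|auto]. intros z Hz.
destruct (G1 z Hz) as [m Hm]. destruct (F1 (g z) (G2 z Hz)) as [l Hl].
exists (l * m). now apply cderiv_comp.
Qed.

Lemma cderiv_self_map_iterate (f : C -> C) (n : nat) :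
  cderiv_self_map f -> cderiv_self_map (iterate n f).
Proof.
intros Hf. induction n as [|n IH].
- split; [|auto]. intros z _. exists 1. apply cderiv_id.
- exact (cderiv_self_map_comp f (iterate n f) Hf IH).
Qed.

Lemma self_map_identity (f g : C -> C) (p : C) :
  cderiv_self_map f -> cderiv_self_map g -> disk p ->
  nonisolated_zero (fun z => f z - g z) p -> forall z, disk z -> f z = g z.
Proof.
intros [F1 F2] [G1 G2] Hp Hz z Hzd.
replace (f z) with (f z - g z + g z) by ring.
rewrite (identity_disk (fun z => f z - g z) p 2); auto; [ring| |].
- intros w Hw. destruct (F1 w Hw) as [l Hl]. destruct (G1 w Hw) as [m Hm].
  exists (l - m). now apply cderiv_minus.
- intros w Hw. eapply Rle_trans; [apply Cmod_triangle_minus|].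
  pose proof (F2 w Hw) as Q1. pose proof (G2 w Hw) as Q2. unfold disk in *. lra.
Qed.

(** Angular derivative 1 at the fixed point [tau], written without a quotient so that the errors
    simply add under composition. *)
Definition near_identity (f : C -> C) (tau : C) : Prop :=
  forall k eta : R, (1 < k)%R -> (0 < eta)%R ->
    exists delta : R, (0 < delta)%R /\
      forall z, stolz_angle tau k z -> (Cmod (z - tau) < delta)%R ->
        (Cmod (f z - z) <= eta * Cmod (z - tau))%R.

Lemma parabolic_near_identity (f : C -> C) (tau : C) : parabolic f tau -> near_identity f tau.
Proof.
intros [_ [Ht [_ [_ H]]]] k eta Hk He. specialize (H k Hk).
assert (L : @locally C_UniformSpace (RtoC 1) (fun y => (Cmod (y - 1) < eta)%R)).
{ apply locally_C. exists (mkposreal eta He). intros y Hy. exact Hy. }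
specialize (H _ L). unfold filtermap, within in H. apply locally_C in H.
destruct H as [[d Hd] P]. exists d; split; [exact Hd|]. intros z Hz Hzd.
specialize (P z Hzd Hz).
assert (N : z - tau <> 0).
{ intros E. destruct Hz as [Hz _]. unfold disk in Hz.
  replace z with (z - tau + tau) in Hz by ring. rewrite E in Hz.
  replace (0 + tau) with tau in Hz by ring. lra. }
replace (f z - z) with (((f z - tau) / (z - tau) - 1) * (z - tau)) by (field; exact N).
rewrite Cmod_mult. apply Rmult_le_compat_r; [apply Cmod_ge_0|lra].
Qed.

(** With [D = |z - tau|], a displacement of at most [D / (4 k)] lowers [2 k (1 - |z|) > 2 D] by at
    most [D / 2], while [|f z - tau| <= 5 / 4 * D]. Doubling the aperture is therefore enough. *)
Lemma near_identity_stolz (f : C -> C) (tau : C) (k : R) :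
  near_identity f tau -> (1 < k)%R ->
  exists delta : R, (0 < delta)%R /\
    forall z, stolz_angle tau k z -> (Cmod (z - tau) < delta)%R ->
      stolz_angle tau (2 * k) (f z) /\ (Cmod (f z - tau) <= 2 * Cmod (z - tau))%R.
Proof.
intros H Hk. destruct (H k (/ (4 * k))%R Hk) as [d [Hd P]].
{ apply Rinv_0_lt_compat; lra. }
exists d; split; [exact Hd|]. intros z [Hz Hs] Hzd. specialize (P z (conj Hz Hs) Hzd).
pose proof (Cmod_ge_0 (z - tau)) as H0. set (D := Cmod (z - tau)) in *.
assert (P' : (k * Cmod (f z - z) <= D / 4)%R).
{ apply (Rmult_le_compat_l k) in P; [|lra].
  replace (k * (/ (4 * k) * D))%R with (D / 4)%R in P by (field; lra). exact P. }
pose proof (Cmod_ge_0 (f z - z)) as H1.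
assert (P1 : (Cmod (f z - z) <= D / 4)%R) by nra.
pose proof (Cmod_chain (f z) z tau) as T. fold D in T.
pose proof (Cmod_le_plus_minus (f z) z) as T2.
assert (Q : (Cmod (f z - tau) < 2 * k * (1 - Cmod (f z)))%R) by nra.
split; [split; [|exact Q]|lra].
unfold disk. pose proof (Cmod_ge_0 (f z - tau)). nra.
Qed.

(** The inner map at most doubles aperture and distance to [tau], so [f] is used with [2 k] and
    [eta / 4]: its error is at most [eta / 4 * 2 D], and [g] contributes [eta / 2 * D]. *)
Lemma near_identity_comp (f g : C -> C) (tau : C) :
  near_identity f tau -> near_identity g tau -> near_identity (fun z => f (g z)) tau.
Proof.
intros Hf Hg k eta Hk He.
destruct (near_identity_stolz g tau k Hg Hk) as [d1 [Hd1 P1]].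
destruct (Hg k (eta / 2)%R Hk ltac:(lra)) as [d2 [Hd2 P2]].
destruct (Hf (2 * k)%R (eta / 4)%R ltac:(lra) ltac:(lra)) as [d3 [Hd3 P3]].
exists (Rmin d1 (Rmin d2 (d3 / 2))). split; [repeat apply Rmin_pos; lra|].
intros z Hz Hzd.
pose proof (Rlt_le_trans _ _ _ Hzd (Rmin_l _ _)) as Z1.
pose proof (Rlt_le_trans _ _ _ Hzd (Rmin_r _ _)) as Z23.
pose proof (Rlt_le_trans _ _ _ Z23 (Rmin_l _ _)) as Z2.
pose proof (Rlt_le_trans _ _ _ Z23 (Rmin_r _ _)) as Z3.
destruct (P1 z Hz Z1) as [S B]. specialize (P2 z Hz Z2). specialize (P3 (g z) S ltac:(lra)).
pose proof (Cmod_chain (f (g z)) (g z) z). nra.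
Qed.

Lemma near_identity_iterate (f : C -> C) (tau : C) (n : nat) :
  near_identity f tau -> near_identity (iterate n f) tau.
Proof.
intros Hf. induction n as [|n IH].
- intros k eta Hk He. exists 1%R; split; [lra|]. intros z _ _. simpl.
  rewrite Cmod_minus_0. apply Rmult_le_pos; [lra|apply Cmod_ge_0].
- exact (near_identity_comp f (iterate n f) tau Hf IH).
Qed.

(** * Uniqueness and injectivity along the radius ending at [tau] *)

Definition radial (tau : C) (s : R) : C := (1 - s)%R * tau.

Lemma radial_minus (tau : C) (s : R) : Cmod tau = 1%R -> (0 < s)%R ->
  Cmod (radial tau s - tau) = s.
Proof.
intros Ht Hs. unfold radial.
replace ((1 - s)%R * tau - tau) with (- (s * tau)) by (rewrite RtoC_minus; ring).
rewrite Cmod_opp, Cmod_mult, Ht, Cmod_R, Rabs_pos_eq; lra.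
Qed.

Lemma radial_Cmod (tau : C) (s : R) : Cmod tau = 1%R -> (0 < s < 1)%R ->
  Cmod (radial tau s) = (1 - s)%R.
Proof.
intros Ht Hs. unfold radial. rewrite Cmod_mult, Ht, Cmod_R, Rabs_pos_eq; lra.
Qed.

Lemma radial_stolz (tau : C) (s : R) : Cmod tau = 1%R -> (0 < s < 1)%R ->
  stolz_angle tau 2 (radial tau s).
Proof.
intros Ht Hs. unfold stolz_angle, disk. rewrite radial_minus, radial_Cmod; lra.
Qed.

(** The identity theorem needs an accumulation point inside the disk, so a point of the radius at
    distance [s1] from [tau] is taken instead of [tau]; nearby points of the radius are the other
    zeros. *)
Lemma self_map_identity_radial (f g : C -> C) (tau : C) (s0 : R) :
  cderiv_self_map f -> cderiv_self_map g -> Cmod tau = 1%R -> (0 < s0)%R ->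
  (forall s : R, (0 < s < 1)%R -> (s < s0)%R -> f (radial tau s) = g (radial tau s)) ->
  forall z, disk z -> f z = g z.
Proof.
intros Hf Hg Ht H0 E.
set (s1 := (Rmin s0 1 / 2)%R).
pose proof (Rmin_l s0 1). pose proof (Rmin_r s0 1). pose proof (Rmin_pos s0 1 H0 Rlt_0_1).
apply (self_map_identity f g (radial tau s1) Hf Hg).
{ unfold disk. rewrite radial_Cmod; unfold s1; lra. }
intros e He. set (d := (Rmin (e / 2) (s1 / 2))%R).
assert (Hd : (0 < d)%R) by (apply Rmin_pos; unfold s1; lra).
pose proof (Rmin_l (e / 2) (s1 / 2)). pose proof (Rmin_r (e / 2) (s1 / 2)). fold d in H2, H3, H4.
assert (Hm : Cmod (radial tau (s1 - d) - radial tau s1) = d).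
{ unfold radial. replace ((1 - (s1 - d))%R * tau - (1 - s1)%R * tau) with (d * tau)
    by (rewrite !RtoC_minus; ring).
  rewrite Cmod_mult, Ht, Cmod_R, Rabs_pos_eq; lra. }
exists (radial tau (s1 - d)). split; [|split].
- intros K. rewrite K, Cmod_minus_0 in Hm. lra.
- rewrite Hm. lra.
- rewrite E; [ring| |]; unfold s1 in *; lra.
Qed.

(* By the Cauchy estimate [f - id], which is small compared with the distance
   to [tau], is a contraction on disks of radius comparable to that distance. *)
Lemma near_identity_injective (f : C -> C) (tau : C) :
  cderiv_self_map f -> near_identity f tau -> Cmod tau = 1%R ->
  exists delta : R, (0 < delta)%R /\
    forall s a b, (0 < s < 1)%R -> (s < delta)%R ->
      (Cmod (a - radial tau s) < s / 4)%R -> (Cmod (b - radial tau s) < s / 4)%R ->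
      f a = f b -> a = b.
Proof.
intros [F1 F2] Hf Ht.
(* The disk of radius [s / 2] about the radial point has [|w - tau| < 3 / 2 * s] and
   [1 - |w| > s / 2], hence lies in aperture 4. There [|f w - w| <= s / 32], which makes the
   Lipschitz constant of [f - id] equal to [1 / 2]. *)
destruct (Hf 4%R (/ 48)%R ltac:(lra) ltac:(lra)) as [d [Hd P]].
exists (d / 2)%R; split; [lra|]. intros s a b Hs Hsd Ha Hb E.
assert (In : forall w, (Cmod (w - radial tau s) < s / 2)%R ->
  stolz_angle tau 4 w /\ (Cmod (w - tau) < 3 / 2 * s)%R).
{ intros w Hw. pose proof (Cmod_chain w (radial tau s) tau) as T.
  rewrite radial_minus in T by lra.
  pose proof (Cmod_le_plus_minus w (radial tau s)) as T2. rewrite radial_Cmod in T2 by lra.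
  unfold stolz_angle, disk. lra. }
assert (L : (Cmod ((f b - b) - (f a - a)) <= 8 * (s / 32) / (s / 2) * Cmod (b - a))%R).
{ apply (holomorphic_lipschitz (fun w => f w - w) (radial tau s) (s / 2) (s / 32)); [lra| | |lra|lra].
  - intros w Hw. destruct (In w Hw) as [[S _] _]. destruct (F1 w S) as [l Hl].
    exists (l - 1). apply cderiv_minus; [exact Hl|apply cderiv_id].
  - intros w Hw. destruct (In w Hw) as [S B]. specialize (P w S ltac:(lra)). lra. }
replace (8 * (s / 32) / (s / 2))%R with (/ 2)%R in L by (field; lra).
rewrite E in L. replace (f b - b - (f b - a)) with (- (b - a)) in L by ring.
rewrite Cmod_opp in L. pose proof (Cmod_ge_0 (b - a)).
assert (Z : b - a = 0) by (apply Cmod_eq_0; lra).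
replace b with (b - a + a) by ring. rewrite Z. ring.
Qed.

(** * Commutation from the functional equations *)

Lemma commute_of_univalent_isogonal (phi psi h : C -> C) (V : C -> Prop) (tau c1 c2 : C) :
  parabolic phi tau -> parabolic psi tau ->
  isogonal V tau -> injective_on V h ->
  (forall z, disk z -> h (phi z) = h z + c1) ->
  (forall z, disk z -> h (psi z) = h z + c2) ->
  forall z, disk z -> phi (psi z) = psi (phi z).
Proof.
intros Hphi Hpsi [_ [_ HV]] Hinj E1 E2.
pose proof (holomorphic_cderiv_self_map phi (proj1 Hphi)) as M1.
pose proof (holomorphic_cderiv_self_map psi (proj1 Hpsi)) as M2.
pose proof (parabolic_near_identity phi tau Hphi) as N1.
pose proof (parabolic_near_identity psi tau Hpsi) as N2.
pose proof (proj1 (proj2 Hphi)) as Ht.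
(* The radius lies in aperture 2, and each composition at most doubles aperture and distance to
   [tau]; hence aperture 4 here and [e / 2] below. *)
destruct (HV (2 * 2)%R ltac:(lra)) as [e [He HeV]].
destruct (near_identity_stolz _ tau 2 (near_identity_comp _ _ _ N1 N2) ltac:(lra)) as [d1 [Hd1 P1]].
destruct (near_identity_stolz _ tau 2 (near_identity_comp _ _ _ N2 N1) ltac:(lra)) as [d2 [Hd2 P2]].
apply (self_map_identity_radial (fun z => phi (psi z)) (fun z => psi (phi z)) tau
  (Rmin (e / 2) (Rmin d1 d2))); try (apply cderiv_self_map_comp; assumption); [exact Ht| |].
{ repeat apply Rmin_pos; lra. }
intros s Hs Hs0.
pose proof (Rlt_le_trans _ _ _ Hs0 (Rmin_l _ _)) as S1.
pose proof (Rlt_le_trans _ _ _ Hs0 (Rmin_r _ _)) as S23.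
pose proof (Rlt_le_trans _ _ _ S23 (Rmin_l _ _)) as S2.
pose proof (Rlt_le_trans _ _ _ S23 (Rmin_r _ _)) as S3.
pose proof (radial_stolz tau s Ht Hs) as St. set (z := radial tau s) in *.
assert (Hz : Cmod (z - tau) = s) by (apply radial_minus; lra).
destruct (P1 z St ltac:(lra)) as [A1 A2]. destruct (P2 z St ltac:(lra)) as [B1 B2].
pose proof (proj1 St) as Dz.
apply Hinj.
- apply HeV; [exact A1|lra].
- apply HeV; [exact B1|lra].
- rewrite E1, E2, E2, E1 by (try apply M1; try apply M2; exact Dz). ring.
Qed.

(** Forward invariance extends the entry time of the orbit of [g p] to all later times, so that two
    maps [g] can share one [n]; openness of [W] and continuity give the neighbourhood. *)
Lemma absorbing_eventually_near (f g : C -> C) (W : C -> Prop) (p : C) :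
  absorbing f W -> cderiv_self_map f -> cderiv_self_map g -> disk p ->
  exists N : nat, forall n : nat, (N <= n)%nat -> exists delta : R, (0 < delta)%R /\
    forall z, (Cmod (z - p) < delta)%R -> W (iterate n f (g z)).
Proof.
intros [[_ [Wo _]] [_ [Winv Wabs]]] Hf Hg Hp.
destruct (Wabs (g p) (proj2 Hg p Hp)) as [N HN]. exists N. intros n Hn.
assert (Wn : W (iterate n f (g p))).
{ replace n with ((n - N) + N)%nat by lia. generalize (n - N)%nat as m.
  induction m as [|m IH]; [exact HN|]. exact (Winv _ IH). }
apply Wo in Wn. apply locally_C in Wn. destruct Wn as [[e He] HW].
destruct (proj1 (cderiv_self_map_comp _ g (cderiv_self_map_iterate f n Hf) Hg) p Hp) as [l Hl].
destruct (cderiv_continuous _ _ _ Hl e He) as [d [Hd P]].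
exists d; split; [exact Hd|]. intros z Hz. apply HW. exact (P z Hz).
Qed.

Lemma translation_iterate (f h : C -> C) (n : nat) :
  (forall z, disk z -> disk (f z)) -> (forall z, disk z -> h (f z) = h z + 1) ->
  forall z, disk z -> h (iterate n f z) = h z + INR n.
Proof.
intros Hf Hh z Hz. induction n as [|n IH].
- simpl. ring.
- change (iterate (S n) f z) with (f (iterate n f z)).
  rewrite Hh, IH, S_INR, RtoC_plus; [ring|].
  clear IH. induction n as [|n IH]; [exact Hz|exact (Hf _ IH)].
Qed.

(* Since only injectivity of [h] on an absorbing domain is available, one first
   gets [phi^n o phi o psi = phi^n o psi o phi] for a single [n], and then
   cancels [phi^n], which is injective near [tau] on Stolz angles. *)
Lemma commute_of_injective_absorbing (phi psi h : C -> C) (W : C -> Prop) (tau c : C) :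
  parabolic phi tau -> parabolic psi tau ->
  absorbing phi W -> injective_on W h ->
  (forall z, disk z -> h (phi z) = h z + 1) ->
  (forall z, disk z -> h (psi z) = h z + c) ->
  forall z, disk z -> phi (psi z) = psi (phi z).
Proof.
intros Hphi Hpsi HW Hinj E1 E2.
pose proof (holomorphic_cderiv_self_map phi (proj1 Hphi)) as M1.
pose proof (holomorphic_cderiv_self_map psi (proj1 Hpsi)) as M2.
pose proof (parabolic_near_identity phi tau Hphi) as N1.
pose proof (parabolic_near_identity psi tau Hpsi) as N2.
pose proof (proj1 (proj2 Hphi)) as Ht.
pose proof (cderiv_self_map_comp _ _ M1 M2) as MA.
pose proof (cderiv_self_map_comp _ _ M2 M1) as MB.
assert (D0 : disk 0) by (unfold disk; rewrite Cmod_0; lra).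
destruct (absorbing_eventually_near phi _ W 0 HW M1 MA D0) as [n1 H1].
destruct (absorbing_eventually_near phi _ W 0 HW M1 MB D0) as [n2 H2].
set (n := max n1 n2).
destruct (H1 n ltac:(lia)) as [d1 [Hd1 W1]]. destruct (H2 n ltac:(lia)) as [d2 [Hd2 W2]].
pose proof (cderiv_self_map_iterate phi n M1) as Mn.
assert (Eq : forall z, disk z -> iterate n phi (phi (psi z)) = iterate n phi (psi (phi z))).
{ apply (self_map_identity (fun z => iterate n phi (phi (psi z)))
     (fun z => iterate n phi (psi (phi z))) 0).
  - exact (cderiv_self_map_comp _ _ Mn MA).
  - exact (cderiv_self_map_comp _ _ Mn MB).
  - exact D0.
  - intros e He. set (s := (Rmin (Rmin e 1) (Rmin d1 d2) / 2)%R).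
    assert (Hs : (0 < s /\ s < e /\ s < 1 /\ s < d1 /\ s < d2)%R).
    { unfold s. pose proof (Rmin_l (Rmin e 1) (Rmin d1 d2)).
      pose proof (Rmin_r (Rmin e 1) (Rmin d1 d2)).
      pose proof (Rmin_l e 1). pose proof (Rmin_r e 1).
      pose proof (Rmin_l d1 d2). pose proof (Rmin_r d1 d2).
      assert (0 < Rmin (Rmin e 1) (Rmin d1 d2))%R by (repeat apply Rmin_pos; lra). lra. }
    assert (Hm : Cmod (s - 0) = s).
    { replace (s - 0) with (RtoC s) by ring. rewrite Cmod_R, Rabs_pos_eq; lra. }
    assert (Ds : disk s) by (unfold disk; rewrite Cmod_R, Rabs_pos_eq; lra).
    exists s. split; [|split].
    + intros K. rewrite K, Cmod_minus_0 in Hm. lra.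
    + rewrite Hm; lra.
    + rewrite (Hinj (iterate n phi (phi (psi s))) (iterate n phi (psi (phi s)))); [ring| | |].
      * apply W1; rewrite Hm; lra.
      * apply W2; rewrite Hm; lra.
      * rewrite !(translation_iterate phi h n (proj2 M1) E1)
          by (apply MA || apply MB; exact Ds).
        rewrite E1, E2, E2, E1 by (try apply M1; try apply M2; exact Ds). ring. }
destruct (near_identity_injective _ tau Mn (near_identity_iterate phi tau n N1) Ht)
  as [d [Hd Inj]].
(* Both compositions move the radial point at distance [s] from [tau] by at most [s / 5], hence stay
   in the disk of radius [s / 4] on which [phi^n] is injective. *)
destruct (near_identity_comp _ _ _ N1 N2 2 (/ 5))%R as [d3 [Hd3 P3]]; [lra|lra|].
destruct (near_identity_comp _ _ _ N2 N1 2 (/ 5))%R as [d4 [Hd4 P4]]; [lra|lra|].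
apply (self_map_identity_radial (fun z => phi (psi z)) (fun z => psi (phi z)) tau
  (Rmin d (Rmin d3 d4)) MA MB Ht); [repeat apply Rmin_pos; lra|].
intros s Hs Hs0.
pose proof (Rlt_le_trans _ _ _ Hs0 (Rmin_l _ _)) as S1.
pose proof (Rlt_le_trans _ _ _ Hs0 (Rmin_r _ _)) as S23.
pose proof (Rlt_le_trans _ _ _ S23 (Rmin_l _ _)) as S2.
pose proof (Rlt_le_trans _ _ _ S23 (Rmin_r _ _)) as S3.
pose proof (radial_stolz tau s Ht Hs) as St.
assert (Hz : Cmod (radial tau s - tau) = s) by (apply radial_minus; lra).
specialize (P3 _ St ltac:(lra)). specialize (P4 _ St ltac:(lra)).
apply (Inj s); [exact Hs|exact S1|lra|lra|]. apply Eq, St.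
Qed.

Theorem proposition3p3 :
  forall (phi psi : C -> C) (tau : C),
    parabolic phi tau -> parabolic psi tau ->
    ((exists (c1 c2 : C) (h : C -> C) (V : C -> Prop),
        holomorphic_on disk h /\
        isogonal V tau /\ univalent_on V h /\
        (forall z, disk z -> h (phi z) = h z + c1) /\
        (forall z, disk z -> h (psi z) = h z + c2)) ->
     forall z, disk z -> phi (psi z) = psi (phi z))
    /\
    (forall h_phi : C -> C, is_koenigs_function phi h_phi ->
     (exists c : C, forall z, disk z -> h_phi (psi z) = h_phi z + c) ->
     forall z, disk z -> psi (phi z) = phi (psi z)).
Proof.
intros phi psi tau Hphi Hpsi. split.
- intros [c1 [c2 [h [V [_ [HV [[_ Hinj] [E1 E2]]]]]]]].
  exact (commute_of_univalent_isogonal phi psi h V tau c1 c2 Hphi Hpsi HV Hinj E1 E2).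
- intros h [S [_ [_ [_ [E1 [_ [W [HW Hinj]]]]]]]] [c E2] z Hz. symmetry.
  exact (commute_of_injective_absorbing phi psi h W tau c Hphi Hpsi HW Hinj E1 E2 z Hz).
Qed.
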